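(* Work over a field of characteristic $0$. Let $(\mathbb A,D)$ be a pair of a quasi-twilled associative algebra $\mathbb A$ with a fixed decomposition $\mathbb A=A\oplus B$ and a strong deformation map $D:A\to B$ in it, and let $\Omega\in\mathscr Q_1$ be the multiplication of $\mathbb A$. Let $(\mathscr Q[1]\oplus\mathfrak a,\{\widetilde l_k\}_{k=1}^\infty)$ be the $L_\infty$-algebra described in the context. Then $(\mathscr Q[1]\oplus\mathfrak a,\{\widetilde l_k^{(\Omega[1],D)}\}_{k=1}^\infty)$ is an $L_\infty$-algebra, where $$\widetilde l_k^{(\Omega[1],D)}\big((F_1[1],f_1),\ldots,(F_k[1],f_k)\big):=\sum_{n=0}^\infty\frac1{n!}\,\widetilde l_{n+k}\big(\underbrace{(\Omega[1],D),\ldots,(\Omega[1],D)}_{n\text{ times}},(F_1[1],f_1),\ldots,(F_k[1],f_k)\big)$$ for $k\ge1$ and homogeneous $(F_1[1],f_1),\ldots,(F_k[1],f_k)\in\mathscr Q[1]\oplus\mathfrak a$. Moreover, for any other element $\Omega'\in\mathscr Q_1$ and linear map $D':A\to B$, the sum $\Omega+\Omega'\in\mathscr Q_1$ represents a quasi-twilled associative algebra structure on $A\oplus B$ and $D+D':A\to B$ is a strong deformation map in this quasi-twilled associative algebra if and only if $(\Omega'[1],D')\in(\mathscr Q[1]\oplus\mathfrak a)_0$ is a Maurer-Cartan element of $(\mathscr Q[1]\oplus\mathfrak a,\{\widetilde l_k^{(\Omega[1],D)}\}_{k=1}^\infty)$.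
   Context: A quasi-twilled associative algebra is an associative algebra with a fixed decomposition $\mathbb A=A\oplus B$ such that $B$ is a subalgebra. Its multiplication has the form $\Omega((a,x),(b,y))=(a\cdot_A b+a\leftharpoonup y+x\rightharpoonup b,\ x\cdot_B y+a\vartriangleright y+x\vartriangleleft b+\theta(a,b))$ for unique bilinear maps $\cdot_A:A\times A\to A$, $\cdot_B:B\times B\to B$, $\vartriangleright:A\times B\to B$, $\vartriangleleft:B\times A\to B$, $\rightharpoonup:B\times A\to A$, $\leftharpoonup:A\times B\to A$, $\theta:A\times A\to B$; elements of $\mathscr Q_1$ (below) are exactly the bilinear maps of this form, and such an element represents a quasi-twilled associative algebra structure if it is associative. A strong deformation map is a linear map $D:A\to B$ with $D(a\cdot_A b+a\leftharpoonup D(b)+D(a)\rightharpoonup b)=D(a)\cdot_B D(b)+a\vartriangleright D(b)+D(a)\vartriangleleft b+\theta(a,b)$ for all $a,b\in A$. Let $\mathfrak g=\bigoplus_{n\ge0}\mathfrak g_n$, $\mathfrak g_n=\mathrm{Hom}((A\oplus B)^{\otimes n+1},A\oplus B)$, with the Gerstenhaber bracket: for $f$ with $m$ inputs and $g$ with $n$ inputs, $[f,g]=f\diamond g-(-1)^{(m-1)(n-1)}g\diamond f$, where $(f\diamond g)(v_1,\ldots,v_{m+n-1})=\sum_{i=1}^m(-1)^{(i-1)(n-1)}f(v_1,\ldots,v_{i-1},g(v_i,\ldots,v_{i+n-1}),v_{i+n},\ldots,v_{m+n-1})$. Let $\mathfrak a=\bigoplus_{n\ge0}\mathfrak a_n$,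 $\mathfrak a_n=\mathrm{Hom}(A^{\otimes n+1},B)\subset\mathfrak g_n$ (extension by zero), and $P:\mathfrak g\to\mathfrak a$ the projection: $P(F)$ is the $B$-component of $F|_{A^{\otimes n+1}}$ for $F\in\mathfrak g_n$. Let $\mathcal A^{k,l}$ be the direct sum of all $(k+l)$-fold tensor products with $k$ factors $A$ and $l$ factors $B$. For $k,l\ge-1$, $k+l=n$, $C^{k|l}\subset\mathfrak g_n$ is the space of $f$ with $f(\mathcal A^{k+1,l})\subset A$, $f(\mathcal A^{k,l+1})\subset B$, $f=0$ on other components. Put $\mathscr Q_n=C^{n+1|-1}\oplus C^{n|0}\oplus\cdots\oplus C^{0|n}$; $\mathscr Q=\bigoplus_{n\ge0}\mathscr Q_n$ is a graded Lie subalgebra of $\mathfrak g$. Write $(\mathscr Q[1])_n=\mathscr Q_{n+1}$, $F[1]$ for $F\in\mathscr Q$ viewed in $\mathscr Q[1]$. The $L_\infty$-structure on $\mathscr Q[1]\oplus\mathfrak a$ has operations $\widetilde l_1(F[1],f)=P(F)$, $\widetilde l_2(F[1],G[1])=(-1)^{|F|}[F,G][1]$ ($|F|$ the degree of $F$ in $\mathscr Q$), $\widetilde l_k(F[1],f_1,\ldots,f_{k-1})=P[\cdots[[F,f_1],f_2],\ldots,f_{k-1}]$ for $k\ge2$, with $F,G\in\mathscr Q$, $f,f_i\in\mathfrak a$ homogeneous; up to permutation of entries all other components vanish. An $L_\infty$-algebra is a graded vector space $\mathcal G$ with graded symmetric (with Koszul sign $\epsilon(\sigma)$) degree $1$ maps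 $l_k:\mathcal G^{\otimes k}\to\mathcal G$, $k\ge1$, such that for all $N\ge1$: $\sum_{i=1}^N\sum_{\sigma\in Sh(i,N-i)}\epsilon(\sigma)\,l_{N-i+1}(l_i(x_{\sigma(1)},\ldots,x_{\sigma(i)}),x_{\sigma(i+1)},\ldots,x_{\sigma(N)})=0$ ($Sh(i,N-i)$ the $(i,N-i)$-shuffles). A Maurer-Cartan element is $\alpha\in\mathcal G_0$ with $\sum_{k\ge1}\frac1{k!}l_k(\alpha,\ldots,\alpha)=0$. All sums occurring here have finitely many nonzero terms. *)

(* Defs.v *)
From HB Require Import structures.
From mathcomp Require Import all_boot all_order all_algebra all_fingroup.
From mathcomp Require Import boolp classical_sets functions cardinality fsbigop.

Set Implicit Arguments.
Unset Strict Implicit.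
Unset Printing Implicit Defensive.

Import GRing.Theory.

Local Open Scope classical_set_scope.
Local Open Scope ring_scope.

(** * L-infinity algebras

    A graded vector space is an independent family [G : int -> set W] of
    subspaces of an ambient vector space [W]; only elements of the [G d] matter.
    Homogeneous elements come tagged with their degree, as pairs [(d, x)] with
    [G d x].  The operations [l_1, l_2, ...] are given by one function [l] on
    lists: the value of [l_k] at [x_1, ..., x_k] of degrees [d_1, ..., d_k] is
    [l [:: (d_1, x_1); ...; (d_k, x_k)]].  The value [l [::]] plays no role. *)

Section Linfty.
Variables (K : fieldType) (W : lmodType K).
Implicit Types (G : int -> set W) (l : seq (int * W) -> W).

Definition subspace (S : set W) : Prop :=
  S 0 /\ forall (a : K) x y, S x -> S y -> S (a *: x + y).

Definition graded_space G : Prop :=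
  (forall d, subspace (G d)) /\
  (forall (s : seq int) (x : int -> W), uniq s ->
     (forall d, d \in s -> G d (x d)) -> \sum_(d <- s) x d = 0 ->
     forall d, d \in s -> x d = 0).

Definition homogeneous G (s : seq (int * W)) : Prop :=
  forall i, (i < size s)%N -> G (nth (0, 0) s i).1 (nth (0, 0) s i).2.

Definition total_degree (s : seq (int * W)) : int := \sum_(x <- s) x.1.

(* x_1 ... x_N = koszul d sigma * x_sigma(1) ... x_sigma(N) in the free graded
   commutative algebra, when x_i has degree d i. *)
Definition koszul N (d : 'I_N -> int) (sigma : 'S_N) : K :=
  \prod_(i < N) \prod_(j < N | (i < j)%N && (sigma j < sigma i)%N)
     (-1) ^ (d (sigma i) * d (sigma j)).

(* sigma(1) < ... < sigma(p) and sigma(p+1) < ... < sigma(N) *)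
Definition shuffle N (p : nat) (sigma : 'S_N) : bool :=
  [forall i : 'I_N, forall j : 'I_N,
     (i < j)%N && ((j < p)%N || (p <= i)%N) ==> (sigma i < sigma j)%N].

Definition permuted N (x : 'I_N -> int * W) (sigma : 'S_N) : seq (int * W) :=
  [seq x (sigma i) | i <- enum 'I_N].

Record is_Linfty G l : Prop := {
  Linfty_graded : graded_space G;
  Linfty_multilinear : forall s1 s2 d (a : K) x y,
    homogeneous G s1 -> homogeneous G s2 -> G d x -> G d y ->
    l (s1 ++ (d, a *: x + y) :: s2)
      = a *: l (s1 ++ (d, x) :: s2) + l (s1 ++ (d, y) :: s2);
  Linfty_degree : forall s, (0 < size s)%N -> homogeneous G s ->
    G (total_degree s + 1) (l s);
  Linfty_symmetric : forall N (x : 'I_N -> int * W) (sigma : 'S_N),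
    (0 < N)%N -> (forall i, G (x i).1 (x i).2) ->
    l (permuted x 1%g)
      = koszul (fun i => (x i).1) sigma *: l (permuted x sigma);
  Linfty_identity : forall N (x : 'I_N -> int * W),
    (0 < N)%N -> (forall i, G (x i).1 (x i).2) ->
    \sum_(1 <= p < N.+1) \sum_(sigma : 'S_N | shuffle p sigma)
       koszul (fun i => (x i).1) sigma *:
       l (let y := permuted x sigma in
          (total_degree (take p y) + 1, l (take p y)) :: drop p y) = 0
}.

Definition finitely_many_nonzero (I : set nat) (u : nat -> W) : Prop :=
  finite_set (I `&` [set n | u n != 0]).

Definition mc_term l (alpha : W) (k : nat) : W :=
  (k`!%:R)^-1 *: l (nseq k (0, alpha)).

(* [\sum_(k \in I)] is the sum of the nonzero terms if there are finitely many
   of them and 0 otherwise, whence the finiteness clause. *)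
Definition maurer_cartan G l (alpha : W) : Prop :=
  [/\ G 0 alpha,
      finitely_many_nonzero [set k | (0 < k)%N] (mc_term l alpha) &
      \sum_(k \in [set k | (0 < k)%N]) mc_term l alpha k = 0].

Definition twist_term l (alpha : W) (s : seq (int * W)) (n : nat) : W :=
  (n`!%:R)^-1 *: l (nseq n (0, alpha) ++ s).

Definition twist l (alpha : W) (s : seq (int * W)) : W :=
  \sum_(n \in [set: nat]) twist_term l alpha s n.

End Linfty.

(** * Multilinear maps

    A linear map from the m-fold tensor power of [U] to [W] is an m-linear map,
    encoded as a function on lists that vanishes on lists of length other than
    [m].  Thus maps of different arities live in one space [seq U -> W], and
    [F : seq U -> W] carries one map for each arity. *)

Definition multilinear (K : fieldType) (U W : lmodType K) (m : nat)
    (f : seq U -> W) : Prop :=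
  (forall s, size s != m -> f s = 0) /\
  (forall s1 s2 (a : K) x y,
     f (s1 ++ (a *: x + y) :: s2) = a *: f (s1 ++ x :: s2) + f (s1 ++ y :: s2)).

Notation cochain A B := (seq (A * B)%type -> (A * B)%type).

Section Cochains.
Variables (K : fieldType) (A B : lmodType K).

Definition inA (a : A) : A * B := (a, 0).
Definition inB (x : B) : A * B := (0, x).

Implicit Types (F H : cochain A B).

(** ** The Gerstenhaber bracket *)

(* [F] has [m] inputs, [H] has [n] inputs, and [v] has length [m + n - 1]; the
   index [i] runs from 0, hence the sign exponent [i * (n - 1)]. *)
Definition diamond (m n : nat) F H (v : seq (A * B)) : A * B :=
  \sum_(i < m) (-1) ^+ (i * n.-1) *:
     F (take i v ++ H (take n (drop i v)) :: drop (i + n) v).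

(* The bracket for [F] of degree [p] and [H] of degree [q]. *)
Definition gerstenhaber (p q : nat) F H (v : seq (A * B)) : A * B :=
  diamond p.+1 q.+1 F H v - (-1) ^+ (p * q) *: diamond q.+1 p.+1 H F v.

(* The bracket on the whole of the direct sum of the g_n: its component of
   degree n, read on lists of length n + 1, is the sum over p + q = n of the
   brackets of the components of degrees p and q. *)
Definition bracket F H : cochain A B := fun v =>
  \sum_(p < size v) gerstenhaber p ((size v).-1 - p) F H v.

(** ** The subspaces a_n and the projection P onto a *)

Definition extend_by_zero (h : seq A -> B) : cochain A B :=
  fun v => inB (h [seq w.1 | w <- v]).

Definition a_ (n : nat) : set (cochain A B) :=
  [set f | exists h : seq A -> B, multilinear n.+1 h /\ f = extend_by_zero h].

Definition proj_a F : cochain A B :=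
  extend_by_zero (fun s => (F [seq inA a | a <- s]).2).

(** ** The subspaces C^(k|l) and Q_n *)

Definition inAB (t : A + B) : A * B :=
  match t with inl a => inA a | inr x => inB x end.

Definition pure_type (k l : int) (t : seq (A + B)) : Prop :=
  (count (fun u => if u is inl _ then true else false) t)%:Z = k /\
  (count (fun u => if u is inr _ then true else false) t)%:Z = l.

(* For [k, l >= -1] with [k + l = n]. *)
Definition C_ (n : nat) (k l : int) : set (cochain A B) :=
  [set f | [/\ multilinear n.+1 f,
    forall t, pure_type (k + 1) l t -> (f [seq inAB u | u <- t]).2 = 0,
    forall t, pure_type k (l + 1) t -> (f [seq inAB u | u <- t]).1 = 0 &
    forall t, ~ pure_type (k + 1) l t -> ~ pure_type k (l + 1) t ->
      f [seq inAB u | u <- t] = 0]].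

Definition Q_ (n : nat) : set (cochain A B) :=
  [set F | exists c : 'I_n.+2 -> cochain A B,
    (forall i : 'I_n.+2, C_ n (n.+1%:Z - i%:Z) (i%:Z - 1) (c i)) /\
    F = \sum_(i < n.+2) c i].

(** ** The L-infinity structure on Q[1] + a

    A pair [(F, f)] stands for [(F[1], f)]. *)

Definition in_degree (S : nat -> set (cochain A B)) (d : int) : set (cochain A B) :=
  if d is Posz n then S n else [set 0].

Definition QA (d : int) : set (cochain A B * cochain A B) :=
  [set x | in_degree Q_ (d + 1) x.1 /\ in_degree a_ d x.2].

Definition ltilde_Q (s : seq (int * (cochain A B * cochain A B))) : cochain A B :=
  if s is [:: (d1, (F1, _)); (_, (F2, _))]
  then ((-1) ^ (d1 + 1) : K) *: bracket F1 F2 else 0.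

(* Multilinear extension and graded symmetry: the i-th summand is the value at
   f_1, ..., f_(i-1), F_i[1], f_(i+1), ..., f_k, whose Koszul sign comes from
   moving F_i[1], of degree d_i, in front of f_1, ..., f_(i-1). *)
Definition ltilde_a (s : seq (int * (cochain A B * cochain A B))) : cochain A B :=
  \sum_(i < size s)
    let x := nth (0, (0, 0)) s i in
    let before := take i s in
    let after := drop i.+1 s in
    ((-1) ^ (x.1 * total_degree before) : K) *:
      proj_a (foldl bracket x.2.1 [seq y.2.2 | y <- before ++ after]).

Definition ltilde (s : seq (int * (cochain A B * cochain A B))) : cochain A B * cochain A B :=
  (ltilde_Q s, ltilde_a s).

(** ** Quasi-twilled associative algebras and strong deformation maps *)

Definition associative_cochain (Omega : cochain A B) : Prop :=
  forall u v w, Omega [:: Omega [:: u; v]; w] = Omega [:: u; Omega [:: v; w]].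

Definition quasi_twilled (Omega : cochain A B) : Prop :=
  [/\ multilinear 2 Omega, associative_cochain Omega &
      forall x y : B, exists z : B, Omega [:: inB x; inB y] = inB z].

Section Components.
Variable Omega : cochain A B.
Definition mulA (a b : A) : A := (Omega [:: inA a; inA b]).1.
Definition theta (a b : A) : B := (Omega [:: inA a; inA b]).2.
Definition harpoon_l (a : A) (y : B) : A := (Omega [:: inA a; inB y]).1.
Definition triangle_r (a : A) (y : B) : B := (Omega [:: inA a; inB y]).2.
Definition harpoon_r (x : B) (b : A) : A := (Omega [:: inB x; inA b]).1.
Definition triangle_l (x : B) (b : A) : B := (Omega [:: inB x; inA b]).2.
Definition mulB (x y : B) : B := (Omega [:: inB x; inB y]).2.

Definition strong_deformation_map (D : A -> B) : Prop :=
  linear D /\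
  forall a b : A,
    D (mulA a b + harpoon_l a (D b) + harpoon_r (D a) b)
    = mulB (D a) (D b) + triangle_r a (D b) + triangle_l (D a) b + theta a b.
End Components.

Definition cochain_of_map (D : A -> B) : cochain A B :=
  extend_by_zero (fun s => if s is [:: a] then D a else 0).

End Cochains.

Arguments QA {K A B}.
Arguments ltilde {K A B}.

(* Main.v *)
(* Give the entries (F_i, f_i) formal parameters that make them all even.  The
   generating function of the operations of Q[1] + a is then the vector field
   V(F, f) = ([F, F] / 2, P e^(ad f) F) up to sign, and being an L-infinity
   algebra means that V squares to zero.  This holds because e^(ad f) is a Lie
   automorphism and P[X, X] / 2 = P[X, P X], as ker P is a subalgebra and the image
   of P is abelian.  Twisting replaces V by V(Omega + F, D + f), which vanishes
   at 0 exactly when (Omega, D) is a Maurer-Cartan element.  On cochains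
   e^(ad D) is the conjugation by the shear (a, x) |-> (a, x + D a); this turns
   the infinite sums into finite expressions in the transported multiplication,
   and turns the Maurer-Cartan equation of (Omega + Omega', D + D') into
   associativity together with the equation of strong deformation maps. *)

Require Import Defs.
From mathcomp Require Import all_boot all_order all_algebra all_fingroup.
From mathcomp Require Import boolp classical_sets functions cardinality fsbigop.
From mathcomp Require Import ring zify.

Set Implicit Arguments.
Unset Strict Implicit.
Unset Printing Implicit Defensive.

Import GRing.Theory.

Local Open Scope classical_set_scope.
Local Open Scope ring_scope.

(** Nothing is deduced from an L-infinity structure on the untwisted operations. The twisted ones
    are summed to the closed form [derived_bracket], and the axioms are checked for it directly,
    with e^(ad D) abstracted to a linear bracket-preserving map [Phi]. The Maurer-Cartan equation of
    the pair then survives only as [[Om, Om] = 0] and [P (Phi Om) = 0]; these make the operation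
    without arguments vanish, so the identities have no curvature term.

    Formal parameters are never introduced: identities between power series become identities
    between coefficients indexed by lists of entries, and products become sums over unshuffles.
    Brackets with elements of [a] act on the right, so inductions add entries at the end of the
    list. Halves are avoided by doubling; characteristic 0 serves to cancel the 2 and to invert
    factorials.

    Cochains of all arities live in one function space, where the Lie axioms are available only
    between homogeneous elements. Hence most steps carry a degree, and negative degrees, which
    contain only 0, are treated apart. *)

Definition oddz (d : int) : bool := odd `|d|%N.

Lemma oddzD (c d : int) : oddz (c + d) = oddz c (+) oddz d.
Proof.
have oddzB (m n : nat) : odd `|m%:Z - n%:Z|%N = odd m (+) odd n.
  wlog le_nm : m n / (n <= m)%N => [IH|].
    case/orP: (leq_total n m) => [/IH//|/IH].
    by rewrite distnC addbC.
  by rewrite distnEl // oddB.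
have E (z : int) : exists m n : nat, z = m%:Z - n%:Z.
  by case: z => n; [exists n, 0%N; rewrite subr0 | exists 0%N, n.+1; rewrite sub0r NegzE].
rewrite /oddz; have [m [n ->]] := E c; have [p [q ->]] := E d.
rewrite addrACA -opprD -!PoszD !oddzB !oddD.
by case: (odd m); case: (odd n); case: (odd p); case: (odd q).
Qed.

Lemma oddzM (c d : int) : oddz (c * d) = oddz c && oddz d.
Proof. by rewrite /oddz abszM oddM. Qed.

Lemma oddz1 : oddz 1 = true. Proof. by []. Qed.
Lemma oddz0 : oddz 0 = false. Proof. by []. Qed.

Lemma exprz_sign (R : unitRingType) (d : int) :
  (-1) ^ d = (-1) ^+ oddz d :> R.
Proof.
rewrite /oddz signr_odd; case: d => n //.
by rewrite -[LHS]/((-1) ^- n.+1) -exprVn invrN1.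
Qed.

Lemma total_degree_cons (K : fieldType) (W : lmodType K) (x : int * W) s :
  total_degree (x :: s) = x.1 + total_degree s.
Proof. by rewrite /total_degree big_cons. Qed.
Lemma total_degree_cat (K : fieldType) (W : lmodType K) (s t : seq (int * W)) :
  total_degree (s ++ t) = total_degree s + total_degree t.
Proof. by rewrite /total_degree big_cat. Qed.
Lemma total_degree_rcons (K : fieldType) (W : lmodType K) s (x : int * W) :
  total_degree (rcons s x) = total_degree s + x.1.
Proof. by rewrite -cats1 total_degree_cat /total_degree big_seq1. Qed.
Lemma total_degree_nil (K : fieldType) (W : lmodType K) :
  total_degree ([::] : seq (int * W)) = 0.
Proof. by rewrite /total_degree big_nil. Qed.

(** Koszul signs depend on degrees only through parities, so splitting on each atomic parity settles
    a sign identity. *)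
Ltac signs := rewrite /= ?(total_degree_cons, total_degree_rcons, total_degree_cat,
  total_degree_nil, oddzD, oddzM, oddz1, oddz0)
  ?(linearZ, linearD, linearN, scalerA, scalerDr, scalerN, scaleNr, opprD, opprK, mulrN, mulNr) /=;
  repeat match goal with |- context [oddz ?x] => case: (oddz x) end;
  rewrite /= ?(expr0, expr1, mulr1, mul1r, mulrN1, mulN1r, opprK, scaleNr, scale1r,
    scalerN, opprD, oppr0, scaler0) //.

(** * Unshuffles *)

Lemma linear_on0 (K : fieldType) (V W : lmodType K) (S : set V) (h : V -> W) :
  S 0 ->
  (forall (c : K) x y, S x -> S y -> h (c *: x + y) = c *: h x + h y) -> h 0 = 0.
Proof.
move=> S0 hl; have := hl 1 0 0 S0 S0; rewrite !scale1r addr0 => /eqP.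
by rewrite -subr_eq0 opprD addrA subrr sub0r oppr_eq0 => /eqP.
Qed.

Lemma linear_map0 (K : fieldType) (V W : lmodType K) (h : V -> W) :
  (forall (c : K) x y, h (c *: x + y) = c *: h x + h y) -> h 0 = 0.
Proof. by move=> hl; apply: (linear_on0 (S := setT)) => // c x y _ _; apply: hl. Qed.

Section Unshuffles.
Variables (K : fieldType) (W : lmodType K).
Local Notation X := (int * W)%type.

(* The sum of [Psi t u] over all ways of splitting [s] into complementary
   subsequences [t] and [u], with the Koszul sign of [s -> t ++ u]. *)
Fixpoint unshuffle_sum (V : lmodType K) (Psi : seq X -> seq X -> V)
    (s : seq X) : V :=
  if s is x :: s' then
    unshuffle_sum (fun t u => Psi (x :: t) u) s' +
    unshuffle_sum (fun t u =>
      (-1) ^+ (oddz x.1 && oddz (total_degree t)) *: Psi t (x :: u)) s'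
  else Psi [::] [::].

Section Basic.
Variable V : lmodType K.
Implicit Types (Psi : seq X -> seq X -> V) (s t u : seq X).

Lemma eq_unshuffle_sum Psi Psi' s :
  (forall t u, perm_eq (t ++ u) s -> Psi t u = Psi' t u) ->
  unshuffle_sum Psi s = unshuffle_sum Psi' s.
Proof.
elim: s Psi Psi' => [|x s IH] Psi Psi' E /=; first exact: E.
congr (_ + _); apply: IH => t u p.
  by apply: E; rewrite cat_cons perm_cons.
by rewrite E // -cat1s perm_catCA cat1s perm_cons.
Qed.

Lemma unshuffle_sumD Psi Psi' s :
  unshuffle_sum (fun t u => Psi t u + Psi' t u) s
    = unshuffle_sum Psi s + unshuffle_sum Psi' s.
Proof.
elim: s Psi Psi' => [//|x s IH] Psi Psi' /=; rewrite [RHS]addrACA; congr (_ + _); rewrite -IH //.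
by apply: eq_unshuffle_sum => t u _; rewrite scalerDr.
Qed.

Lemma unshuffle_sumZ (a : K) Psi s :
  unshuffle_sum (fun t u => a *: Psi t u) s = a *: unshuffle_sum Psi s.
Proof.
elim: s Psi => [//|x s IH] Psi /=; rewrite scalerDr; congr (_ + _); rewrite -IH //.
by apply: eq_unshuffle_sum => t u _; rewrite !scalerA mulrC.
Qed.

Lemma unshuffle_sum0 Psi s :
  (forall t u, perm_eq (t ++ u) s -> Psi t u = 0) -> unshuffle_sum Psi s = 0.
Proof.
move=> E; rewrite (@eq_unshuffle_sum _ (fun t u => 0 *: Psi t u)).
  by rewrite unshuffle_sumZ scale0r.
by move=> t u p; rewrite E // scaler0.
Qed.

Lemma unshuffle_sum_first Psi s :
  (forall t u, perm_eq (t ++ u) s -> t != [::] -> Psi t u = 0) ->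
  unshuffle_sum Psi s = Psi [::] s.
Proof.
elim: s Psi => [//|x s IH] Psi Psi0 /=.
rewrite unshuffle_sum0 ?add0r => [|t u p]; last first.
  by apply: Psi0 => //; rewrite cat_cons perm_cons.
rewrite IH => [|t u p t0]; first by rewrite total_degree_nil oddz0 andbF scale1r.
by rewrite Psi0 ?scaler0 // -cat1s perm_catCA cat1s perm_cons.
Qed.

Lemma perm_total_degree s t : perm_eq s t -> total_degree s = total_degree t.
Proof. exact: perm_big. Qed.

(** The recursion of [unshuffle_sum] peels off the first entry, but iterated brackets grow at the
    end. A last entry that goes to the first half has to cross all of [u], whence the extra sign. *)
Lemma unshuffle_sum_rcons Psi s x :
  unshuffle_sum Psi (rcons s x) =
    unshuffle_sum (fun t u =>
      (-1) ^+ (oddz x.1 && oddz (total_degree u)) *: Psi (rcons t x) u) s +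
    unshuffle_sum (fun t u => Psi t (rcons u x)) s.
Proof.
elim: s Psi => [|y s IH] Psi /=; first by signs.
rewrite !IH [RHS]addrACA; congr (_ + _ + (_ + _)).
by apply: eq_unshuffle_sum => t u _; rewrite !scalerA; congr (_ *: _); signs.
Qed.

(** Exchanging the halves costs the sign of moving all of [t] past all of [u]. This later identifies
    the two mixed terms of a self-bracket. *)
Lemma unshuffle_sumC Psi s :
  unshuffle_sum Psi s =
    unshuffle_sum (fun t u =>
      (-1) ^+ (oddz (total_degree t) && oddz (total_degree u)) *: Psi u t) s.
Proof.
elim: s Psi => [|x s IH] Psi /=; first by signs.
rewrite [LHS]addrC; congr (_ + _); rewrite IH; apply: eq_unshuffle_sum => t u _;
  rewrite ?scalerA; congr (_ *: _); signs.
Qed.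

End Basic.

(** Linearity is asked on [S] only, since a map such as [br _ y] is known to be linear only within
    one degree. *)
Lemma unshuffle_sum_map (V V' : lmodType K) (S : set V) (h : V -> V')
    (Psi : seq X -> seq X -> V) s :
    subspace S ->
    (forall (a : K) x y, S x -> S y -> h (a *: x + y) = a *: h x + h y) ->
    (forall t u, perm_eq (t ++ u) s -> S (Psi t u)) ->
  S (unshuffle_sum Psi s) /\
  h (unshuffle_sum Psi s) = unshuffle_sum (fun t u => h (Psi t u)) s.
Proof.
move=> [S0 SD] hD; have h0 : h 0 = 0 by exact: linear_on0 hD.
have SZ a x : S x -> S (a *: x) by move=> Sx; rewrite -[_ *: _]addr0; apply: SD.
have hZ a x : S x -> h (a *: x) = a *: h x.
  by move=> Sx; rewrite -[_ *: _]addr0 hD // h0 addr0.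
elim: s Psi => [|x s IH] Psi SPsi /=; first by split => //; apply: SPsi.
have [|S1 E1] := IH (fun t u => Psi (x :: t) u).
  by move=> t u p; apply: SPsi; rewrite cat_cons perm_cons.
have S2' t u : perm_eq (t ++ u) s -> S (Psi t (x :: u)).
  by move=> p; apply: SPsi; rewrite -cat1s perm_catCA cat1s perm_cons.
have [|S2 E2] := IH (fun t u =>
      (-1) ^+ (oddz x.1 && oddz (total_degree t)) *: Psi t (x :: u)).
  by move=> t u p; apply/SZ/S2'.
split; first by rewrite -[X in X + _]scale1r; apply: SD.
rewrite -[X in h (X + _)]scale1r hD // scale1r E1 E2; congr (_ + _).
by apply: eq_unshuffle_sum => t u p; rewrite hZ //; apply: S2'.
Qed.

End Unshuffles.

(** * Higher derived brackets *)

(** The Jacobi identity is stated as the derivation property of the right action of [z], the form in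
    which iterated brackets [[[F, f_1], f_2]] use it. Linearity in the second argument follows by
    antisymmetry. *)
Record graded_lie (K : fieldType) (V : lmodType K) (g : int -> set V)
    (br : V -> V -> V) : Prop := {
  lie_subspace : forall d, subspace (g d);
  lie_closed : forall p q x y, g p x -> g q y -> g (p + q) (br x y);
  lie_linear : forall p q (a : K) x x' y, g p x -> g p x' -> g q y ->
    br (a *: x + x') y = a *: br x y + br x' y;
  lie_anti : forall p q x y, g p x -> g q y ->
    br x y = - ((-1) ^+ (oddz p && oddz q) *: br y x);
  lie_jacobi : forall p q r x y z, g p x -> g q y -> g r z ->
    br (br x y) z = br x (br y z) + (-1) ^+ (oddz q && oddz r) *: br (br x z) y
}.

Section GradedLie.
Variables (K : fieldType) (V : lmodType K) (g : int -> set V) (br : V -> V -> V).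
Hypothesis L : graded_lie g br.

Lemma lie_mem_eq p q x : g p x -> p = q -> g q x. Proof. by move=> ? <-. Qed.
Lemma lie_mem0 p : g p 0. Proof. by have [] := lie_subspace L p. Qed.
Lemma lie_memZ p (a : K) x : g p x -> g p (a *: x).
Proof.
move=> gx; rewrite -[_ *: _]addr0.
by apply: (lie_subspace L p).2 => //; apply: lie_mem0.
Qed.
Lemma lie_memD p x y : g p x -> g p y -> g p (x + y).
Proof. by move=> gx gy; rewrite -[x]scale1r; apply: (lie_subspace L p).2. Qed.
Lemma lie_memN p x : g p x -> g p (- x).
Proof. by move=> gx; rewrite -scaleN1r; apply: lie_memZ. Qed.
Lemma lie_mem_sum p (I : Type) (r : seq I) (Q : pred I) (F : I -> V) :
  (forall i, Q i -> g p (F i)) -> g p (\sum_(i <- r | Q i) F i).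
Proof. by move=> gF; elim/big_ind: _ => //; [exact: lie_mem0 | move=> *; exact: lie_memD]. Qed.

Lemma br0l q y : g q y -> br 0 y = 0.
Proof.
move=> gy; apply: (linear_on0 (S := g 0) (h := br^~ y)) => [|c x x' gx gx'].
  exact: lie_mem0.
exact: (lie_linear L c gx gx' gy).
Qed.
Lemma br0r p x : g p x -> br x 0 = 0.
Proof. by move=> gx; rewrite (lie_anti L gx (lie_mem0 0)) (br0l gx) scaler0 oppr0. Qed.
Lemma brDl p q x x' y : g p x -> g p x' -> g q y -> br (x + x') y = br x y + br x' y.
Proof. by move=> gx gx' gy; rewrite -[x in LHS]scale1r (lie_linear L _ gx gx' gy) scale1r. Qed.
Lemma brZl p q (a : K) x y : g p x -> g q y -> br (a *: x) y = a *: br x y.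
Proof.
move=> gx gy; rewrite -[_ *: x]addr0.
by rewrite (lie_linear L _ gx (lie_mem0 p) gy) (br0l gy) addr0.
Qed.
Lemma brDr p q x y y' : g p x -> g q y -> g q y' -> br x (y + y') = br x y + br x y'.
Proof.
move=> gx gy gy'; rewrite (lie_anti L gx (lie_memD gy gy')) (brDl gy gy' gx).
by rewrite (lie_anti L gx gy) (lie_anti L gx gy') scalerDr opprD.
Qed.
Lemma brZr p q (a : K) x y : g p x -> g q y -> br x (a *: y) = a *: br x y.
Proof.
move=> gx gy; rewrite (lie_anti L gx (lie_memZ a gy)) (brZl _ gy gx) (lie_anti L gx gy).
by rewrite scalerN !scalerA mulrC.
Qed.
Lemma brNl p q x y : g p x -> g q y -> br (- x) y = - br x y.
Proof. by move=> gx gy; rewrite -scaleN1r (brZl _ gx gy) scaleN1r. Qed.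
Lemma brNr p q x y : g p x -> g q y -> br x (- y) = - br x y.
Proof. by move=> gx gy; rewrite -scaleN1r (brZr _ gx gy) scaleN1r. Qed.
Lemma br_suml p q y (I : Type) (r : seq I) (Q : pred I) (F : I -> V) :
  (forall i, Q i -> g p (F i)) -> g q y ->
  br (\sum_(i <- r | Q i) F i) y = \sum_(i <- r | Q i) br (F i) y.
Proof.
move=> gF gy; suff [] : g p (\sum_(i <- r | Q i) F i) /\
  br (\sum_(i <- r | Q i) F i) y = \sum_(i <- r | Q i) br (F i) y by [].
elim/big_rec2: _ => [|i u v Qi [gv E]]; first by rewrite (br0l gy); split=> //; exact: lie_mem0.
by split; [exact: lie_memD (gF _ Qi) gv | rewrite (brDl (gF _ Qi) gv gy) E].
Qed.

End GradedLie.

(** [D] enters only through [Phi], which stands for e^(ad D); [dd_OmOm] and [dd_P_Om] together are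
    the Maurer-Cartan equation of the pair. *)
Record derived_data (K : fieldType) (V : lmodType K) (g : int -> set V)
    (br : V -> V -> V) (a : int -> set V) (P Phi : V -> V) (Om : V) : Prop := {
  dd_lie : graded_lie g br;
  dd_a_subspace : forall d, subspace (a d);
  dd_a : forall d x, a d x -> g d x;
  dd_P_linear : forall (c : K) x y, P (c *: x + y) = c *: P x + P y;
  dd_P : forall d x, g d x -> a d (P x);
  dd_P_id : forall d x, a d x -> P x = x;
  dd_a_abelian : forall p q x y, a p x -> a q y -> br x y = 0;
  dd_ker : forall p q x y, g p x -> g q y -> P x = 0 -> P y = 0 -> P (br x y) = 0;
  dd_Phi_linear : forall (c : K) x y, Phi (c *: x + y) = c *: Phi x + Phi y;
  dd_Phi : forall d x, g d x -> g d (Phi x);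
  dd_Phi_br : forall p q x y, g p x -> g q y -> Phi (br x y) = br (Phi x) (Phi y);
  dd_Om : g 1 Om;
  dd_OmOm : br Om Om = 0;
  dd_P_Om : P (Phi Om) = 0
}.

Section Derived.
Variables (K : fieldType) (V : lmodType K) (g : int -> set V).
Variables (br : V -> V -> V) (a : int -> set V) (P Phi : V -> V) (Om : V).
Hypothesis charK : [pchar K] =i pred0.
Hypothesis dd : derived_data g br a P Phi Om.
Let L := dd_lie dd.

Local Notation X := (int * (V * V))%type.
Implicit Types (s t u : seq X) (x y : X).

(** The shift of Q[1] puts [F] one degree above the entry. [F] ranges over all of [g], where the
    identities already hold; Q returns in [derived_bracket_closed]. *)
Definition admissible x := g (x.1 + 1) x.2.1 /\ a x.1 x.2.2.
Definition all_admissible s := forall x, x \in s -> admissible x.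

Definition iter_ad s (F : V) : V := foldl br F [seq x.2.2 | x <- s].

(* The coefficient of theta_s in e^(ad f) (Omega + F), where F + f is the sum of
   the entries of [s] multiplied by formal parameters theta_x that make them
   even. *)
Definition derived_sum s : V :=
  iter_ad s (Phi Om) +
  \sum_(i < size s)
    (-1) ^+ (oddz (nth (0, 0) s i).1 && oddz (total_degree (take i s))) *:
      iter_ad (take i s ++ drop i.+1 s) (Phi (nth (0, 0) s i).2.1).

(** Polarization of [C, C] / 2 at C = Omega + F, with the signs of [ltilde_Q]: the exponent is the
    degree in Q of the first argument, which is 1 for Omega and [x.1 + 1] for an entry. *)
Definition quadratic_part s : V :=
  match s with
  | [:: x] => - br Om x.2.1
  | [:: x; y] => (-1) ^+ (~~ oddz x.1) *: br x.2.1 y.2.1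
  | _ => 0
  end.

Definition derived_bracket s : V * V := (quadratic_part s, P (derived_sum s)).

Let fg x : admissible x -> g x.1 x.2.2. Proof. by move=> [_ /(dd_a dd)]. Qed.
Let Fg x : admissible x -> g (x.1 + 1) (Phi x.2.1). Proof. by move=> [/(dd_Phi dd)]. Qed.

Lemma all_admissible_cons x s : all_admissible (x :: s) <-> admissible x /\ all_admissible s.
Proof.
split=> [H|[hx hs] y]; first by split=> [|y ys]; apply: H; rewrite in_cons ?eqxx // ys orbT.
by rewrite in_cons => /orP[/eqP->|/hs].
Qed.
Lemma all_admissible_cat s t : all_admissible (s ++ t) <-> all_admissible s /\ all_admissible t.
Proof.
elim: s => [|x s IH] /=; first by split=> [|[]].
by rewrite !all_admissible_cons IH; tauto.
Qed.
Lemma all_admissible_rcons s x : all_admissible (rcons s x) <-> all_admissible s /\ admissible x.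
Proof.
by rewrite -cats1 all_admissible_cat all_admissible_cons; split=> [[? []]|[]].
Qed.
Lemma all_admissible_perm s t : perm_eq t s -> all_admissible s -> all_admissible t.
Proof. by move=> /perm_mem E H x; rewrite E; apply: H. Qed.

Lemma unshuffled s t u : all_admissible s -> perm_eq (t ++ u) s ->
  [/\ all_admissible t, all_admissible u & total_degree t + total_degree u = total_degree s].
Proof.
move=> hs p; have /all_admissible_cat[? ?] := all_admissible_perm p hs; split=> //.
by rewrite -(perm_total_degree p) total_degree_cat.
Qed.

Lemma iter_ad_rcons s x F : iter_ad (rcons s x) F = br (iter_ad s F) x.2.2.
Proof. by rewrite /iter_ad map_rcons foldl_rcons. Qed.

Lemma iter_ad_closed p s F : all_admissible s -> g p F -> g (p + total_degree s) (iter_ad s F).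
Proof.
elim/last_ind: s => [|s x IH] /=; first by rewrite total_degree_nil addr0.
move=> /all_admissible_rcons[hs hx] gF; rewrite iter_ad_rcons total_degree_rcons addrA.
by apply: (lie_closed L) (IH hs gF) (fg hx).
Qed.

Lemma iter_ad_linear p s (c : K) F G : all_admissible s -> g p F -> g p G ->
  iter_ad s (c *: F + G) = c *: iter_ad s F + iter_ad s G.
Proof.
elim/last_ind: s => [//|s x IH] /all_admissible_rcons[hs hx] gF gG.
rewrite !iter_ad_rcons IH //.
exact: (lie_linear L _ (iter_ad_closed hs gF) (iter_ad_closed hs gG) (fg hx)).
Qed.

(** In the Jacobi identity the term with the bracket of [x.2.2] and [y.2.2] vanishes because [a] is
    abelian; only the interchanged term is left. *)
Lemma br_fC p F x y : g p F -> admissible x -> admissible y ->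
  br (br F x.2.2) y.2.2 = (-1) ^+ (oddz x.1 && oddz y.1) *: br (br F y.2.2) x.2.2.
Proof.
move=> gF hx hy; rewrite (lie_jacobi L gF (fg hx) (fg hy)).
rewrite (dd_a_abelian dd hx.2 hy.2).
by rewrite (br0r L gF) add0r.
Qed.

Lemma iter_ad_cons p F y u : g p F -> admissible y -> all_admissible u ->
  iter_ad (y :: u) F = (-1) ^+ (oddz y.1 && oddz (total_degree u)) *: br (iter_ad u F) y.2.2.
Proof.
move=> gF hy; elim/last_ind: u => [|u x IH] hu; first by signs.
have [{}hu hx] := (all_admissible_rcons _ _).1 hu.
rewrite -rcons_cons iter_ad_rcons IH // iter_ad_rcons.
have gA := iter_ad_closed hu gF.
rewrite (brZl L _ (lie_closed L gA (fg hy)) (fg hx)) (br_fC gA hy hx) scalerA.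
by congr (_ *: _); signs.
Qed.

Lemma derived_sum_nil : derived_sum [::] = Phi Om.
Proof. by rewrite /derived_sum big_ord0 addr0. Qed.

Lemma derived_sum_term_rcons s x (i : 'I_(size s)) :
  iter_ad (take i (rcons s x) ++ drop i.+1 (rcons s x)) (Phi (nth (0, 0) (rcons s x) i).2.1)
  = br (iter_ad (take i s ++ drop i.+1 s) (Phi (nth (0, 0) s i).2.1)) x.2.2.
Proof.
rewrite -!cats1 take_cat drop_cat nth_cat ltn_ord.
case: ltnP => [_|le_s]; first by rewrite catA cats1 iter_ad_rcons.
have -> : i.+1 = size s by apply/eqP; rewrite eqn_leq le_s ltn_ord.
by rewrite subnn drop0 drop_size cats0 cats1 iter_ad_rcons.
Qed.

Lemma derived_sum_term_closed s (i : 'I_(size s)) : all_admissible s ->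
  g (1 + total_degree s)
    (iter_ad (take i s ++ drop i.+1 s) (Phi (nth (0, 0) s i).2.1)).
Proof.
move=> hs; have E := cat_take_drop i s.
rewrite (drop_nth (0, 0) (ltn_ord i)) in E.
have /all_admissible_cat[h1 /all_admissible_cons[h2 h3]] :
    all_admissible (take i s ++ nth (0, 0) s i :: drop i.+1 s).
  by rewrite E.
apply: lie_mem_eq (iter_ad_closed _ (Fg h2)) _; first exact/all_admissible_cat.
rewrite -[in RHS]E !total_degree_cat total_degree_cons; ring.
Qed.

Lemma derived_sum_closed s : all_admissible s -> g (1 + total_degree s) (derived_sum s).
Proof.
move=> hs; apply: (lie_memD L); first exact: iter_ad_closed hs (dd_Phi dd (dd_Om dd)).
by apply: (lie_mem_sum L) => i _; apply: (lie_memZ L); apply: derived_sum_term_closed.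
Qed.

(** A product rule: the new entry enters either through its [a]-part, as one more bracket, or
    through its Q-part, which takes the innermost place and so crosses all of [s]. *)
Lemma derived_sum_rcons s x : all_admissible s -> admissible x ->
  derived_sum (rcons s x) = br (derived_sum s) x.2.2 +
    (-1) ^+ (oddz x.1 && oddz (total_degree s)) *: iter_ad s (Phi x.2.1).
Proof.
move=> hs hx; rewrite {1}/derived_sum size_rcons big_ord_recr /= nth_rcons ltnn eqxx.
rewrite drop_oversize ?size_rcons // cats0 -cats1 take_size_cat // cats1 addrA.
congr (_ + _); rewrite iter_ad_rcons.
rewrite (brDl L (iter_ad_closed hs (dd_Phi dd (dd_Om dd))) _ (fg hx)); last first.
  by apply: (lie_mem_sum L) => i _; apply: (lie_memZ L); apply: derived_sum_term_closed.
congr (_ + _); rewrite (br_suml L (p := 1 + total_degree s) _ _ (fg hx)).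
  apply: eq_bigr => i _; rewrite (brZl L _ (derived_sum_term_closed i hs) (fg hx)).
  rewrite derived_sum_term_rcons nth_rcons ltn_ord -cats1 takel_cat //.
  exact: ltnW.
by move=> i _; apply: (lie_memZ L); apply: derived_sum_term_closed.
Qed.

(** The form needed for the L-infinity identity, where the inner value stands first in the outer
    argument list. *)
Lemma derived_sum_cons y u : admissible y -> all_admissible u ->
  derived_sum (y :: u) = iter_ad u (Phi y.2.1) +
    (-1) ^+ (oddz y.1 && oddz (total_degree u)) *: br (derived_sum u) y.2.2.
Proof.
move=> hy; elim/last_ind: u => [|u x IH] hu.
  rewrite -[[:: y]]/(rcons [::] y) derived_sum_rcons // [in LHS]addrC.
  by congr (_ + _); signs; case: ifP.
have [{}hu hx] := (all_admissible_rcons _ _).1 hu.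
have hyu : all_admissible (y :: u) by apply/all_admissible_cons.
have gu := lie_closed L (derived_sum_closed hu).
rewrite -rcons_cons derived_sum_rcons // IH // iter_ad_rcons.
rewrite (brDl L (p := 1 + (y.1 + total_degree u)) _ _ (fg hx)); first last.
- by apply: (lie_memZ L); apply: lie_mem_eq (gu _ _ (fg hy)) _; ring.
- by apply: lie_mem_eq (iter_ad_closed hu (Fg hy)) _; ring.
rewrite -addrA; congr (_ + _).
rewrite (brZl L _ (gu _ _ (fg hy)) (fg hx)) (br_fC (derived_sum_closed hu) hy hx).
rewrite (iter_ad_cons (Fg hx) hy hu) derived_sum_rcons //.
rewrite (brDl L (p := 1 + (x.1 + total_degree u)) _ _ (fg hy)); first last.
- by apply: (lie_memZ L); apply: lie_mem_eq (iter_ad_closed hu (Fg hx)) _; ring.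
- by apply: lie_mem_eq (gu _ _ (fg hx)) _; ring.
rewrite (brZl L _ (iter_ad_closed hu (Fg hx)) (fg hy)) scalerDr !scalerA.
by congr (_ *: _ + _ *: _); signs.
Qed.

(* The coefficient of theta_s in the bracket of two elements with coefficients
   [Z] and [Z'] of degrees p and q; the sign is the one for which bracketing with
   [x.2.2] acts by the Leibniz rule in [conv_bracket_rcons]. *)
Definition conv_bracket (q : int) (Z Z' : seq X -> V) s : V :=
  unshuffle_sum (fun t u => (-1) ^+ (oddz q && oddz (total_degree t)) *:
    br (Z t) (Z' u)) s.

Lemma conv_bracket_closed p q (Z Z' : seq X -> V) s : all_admissible s ->
  (forall t, all_admissible t -> g (p + total_degree t) (Z t)) ->
  (forall t, all_admissible t -> g (q + total_degree t) (Z' t)) ->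
  g (p + q + total_degree s) (conv_bracket q Z Z' s).
Proof.
move=> hs gZ1 gZ2; apply: (unshuffle_sum_map (h := id) (lie_subspace L _) _ _).1 => // t u.
move=> /(unshuffled hs)[ht hu <-]; apply: (lie_memZ L).
by apply: lie_mem_eq (lie_closed L (gZ1 _ ht) (gZ2 _ hu)) _; ring.
Qed.

(** [Y] and [Y'] are the derivatives of [Z] and [Z'] along the Q-part of [x]; the bracket with
    [x.2.2] distributes over the two factors by the Jacobi identity. *)
Lemma conv_bracket_rcons p q (Z Z' Y Y' : seq X -> V) s x : all_admissible s -> admissible x ->
  (forall t, all_admissible t -> g (p + total_degree t) (Z t)) ->
  (forall t, all_admissible t -> g (q + total_degree t) (Z' t)) ->
  (forall t, all_admissible t -> g (p + x.1 + total_degree t) (Y t)) ->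
  (forall t, all_admissible t -> g (q + x.1 + total_degree t) (Y' t)) ->
  (forall t, all_admissible t -> Z (rcons t x) = br (Z t) x.2.2 +
     (-1) ^+ (oddz x.1 && oddz (total_degree t)) *: Y t) ->
  (forall t, all_admissible t -> Z' (rcons t x) = br (Z' t) x.2.2 +
     (-1) ^+ (oddz x.1 && oddz (total_degree t)) *: Y' t) ->
  conv_bracket q Z Z' (rcons s x) = br (conv_bracket q Z Z' s) x.2.2 +
    ((-1) ^+ (oddz x.1 && oddz (total_degree s + q)) *: conv_bracket q Y Z' s +
    (-1) ^+ (oddz x.1 && oddz (total_degree s)) *: conv_bracket (q + x.1) Z Y' s).
Proof.
move=> hs hx gZ1 gZ2 gY1 gY2 E1 E2.
rewrite /conv_bracket.
have [|||_ ->] := unshuffle_sum_map (s := s) (S := g (p + q + total_degree s))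
  (Psi := fun t u => (-1) ^+ (oddz q && oddz (total_degree t)) *: br (Z t) (Z' u))
  (h := fun F => br F x.2.2) _ _ _.
- exact: (lie_subspace L).
- by move=> c F G gF gG; apply: (lie_linear L _ gF gG (fg hx)).
- move=> t u /(unshuffled hs)[ht hu <-]; apply: (lie_memZ L).
  by apply: lie_mem_eq (lie_closed L (gZ1 _ ht) (gZ2 _ hu)) _; ring.
rewrite unshuffle_sum_rcons -!unshuffle_sumZ -!unshuffle_sumD.
apply: eq_unshuffle_sum => t u /(unshuffled hs)[ht hu <-].
have gf := fg hx; have gt := gZ1 t ht; have gu := gZ2 u hu.
have gy := gY1 t ht; have gy' := gY2 u hu.
have gtf := lie_closed L gt gf; have guf := lie_closed L gu gf.
rewrite E1 // E2 //.
rewrite (brDl L (p := p + total_degree t + x.1) (q := q + total_degree u)) //; last first.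
  by apply: (lie_memZ L); apply: lie_mem_eq gy _; ring.
rewrite (brDr L (p := p + total_degree t) (q := q + total_degree u + x.1)) //; last first.
  by apply: (lie_memZ L); apply: lie_mem_eq gy' _; ring.
rewrite (brZl L _ gy gu) (brZr L _ gt gy') (brZl L _ (lie_closed L gt gu) gf).
rewrite (lie_jacobi L gt gu gf).
rewrite !scalerDr !scalerA -!addrA [RHS]addrCA; congr (_ + _).
  by congr (_ *: _); signs.
by rewrite [LHS]addrCA; congr (_ + (_ + _)); congr (_ *: _); signs.
Qed.

Lemma conv_bracket0l p q (Z : seq X -> V) s : all_admissible s ->
  (forall t, all_admissible t -> g (p + total_degree t) (Z t)) ->
  conv_bracket q (fun=> 0) Z s = 0.
Proof.
move=> hs gZ1; apply: unshuffle_sum0 => t u /(unshuffled hs)[ht hu _].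
by rewrite (br0l L (gZ1 _ hu)) scaler0.
Qed.

Lemma conv_bracket0r p q (Z : seq X -> V) s : all_admissible s ->
  (forall t, all_admissible t -> g (p + total_degree t) (Z t)) ->
  conv_bracket q Z (fun=> 0) s = 0.
Proof.
move=> hs gZ1; apply: unshuffle_sum0 => t u /(unshuffled hs)[ht hu _].
by rewrite (br0r L (gZ1 _ ht)) scaler0.
Qed.

Lemma iter_ad_split p F t x : g p F -> all_admissible t ->
  iter_ad (rcons t x) F = br (iter_ad t F) x.2.2 +
     (-1) ^+ (oddz x.1 && oddz (total_degree t)) *: 0.
Proof. by move=> _ _; rewrite iter_ad_rcons scaler0 addr0. Qed.

(** Neither [F] nor [G] depends on the new entry, so [Y] and [Y'] are 0 and only the Leibniz term is
    left: e^(ad f) is a Lie automorphism, coefficient by coefficient. *)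
Lemma conv_bracket_iter_ad p q F G s : g p F -> g q G -> all_admissible s ->
  conv_bracket q (iter_ad^~ F) (iter_ad^~ G) s = iter_ad s (br F G).
Proof.
move=> gF gG; elim/last_ind: s => [|s x IH]; first by move=> _; rewrite /conv_bracket; signs.
move=> /all_admissible_rcons[hs hx].
have gAF t : all_admissible t -> g (p + total_degree t) (iter_ad t F).
  by move=> ht; apply: iter_ad_closed.
have gAG t : all_admissible t -> g (q + total_degree t) (iter_ad t G).
  by move=> ht; apply: iter_ad_closed.
rewrite (conv_bracket_rcons (p := p) (Y := fun=> 0) (Y' := fun=> 0)) ?IH //.
- by rewrite (conv_bracket0l _ hs gAG) (conv_bracket0r _ hs gAF) !scaler0 !addr0 iter_ad_rcons.
- by move=> *; apply: (lie_mem0 L).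
- by move=> *; apply: (lie_mem0 L).
- by move=> t; apply: iter_ad_split gF.
- by move=> t; apply: iter_ad_split gG.
Qed.

Lemma conv_bracket_iter_ad_derived_sum_rcons p F s x : g p F -> all_admissible s -> admissible x ->
  conv_bracket 1 (iter_ad^~ F) derived_sum (rcons s x) =
    br (conv_bracket 1 (iter_ad^~ F) derived_sum s) x.2.2 +
    (-1) ^+ (oddz x.1 && oddz (total_degree s)) *: iter_ad s (br F (Phi x.2.1)).
Proof.
move=> gF hs hx.
have gAF t : all_admissible t -> g (p + total_degree t) (iter_ad t F).
  by move=> ht; apply: iter_ad_closed.
rewrite (conv_bracket_rcons (p := p) (Y := fun=> 0) (Y' := iter_ad^~ (Phi x.2.1))) //.
- rewrite (conv_bracket0l _ hs derived_sum_closed) scaler0 add0r (conv_bracket_iter_ad gF _ hs) //.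
  by apply: lie_mem_eq (Fg hx) _; ring.
- exact: derived_sum_closed.
- by move=> *; apply: (lie_mem0 L).
- by move=> t ht; apply: iter_ad_closed => //; apply: lie_mem_eq (Fg hx) _; ring.
- by move=> t; apply: iter_ad_split gF.
- by move=> t ht; apply: derived_sum_rcons.
Qed.

Lemma conv_bracket_derived_sum_iter_ad (d : int) F s : g (d + 1) F -> all_admissible s ->
  conv_bracket (1 + d) derived_sum (iter_ad^~ F) s =
    (-1) ^+ oddz d *: conv_bracket 1 (iter_ad^~ F) derived_sum s.
Proof.
move=> gF hs; rewrite /conv_bracket unshuffle_sumC -unshuffle_sumZ.
apply: eq_unshuffle_sum => t u /(unshuffled hs)[ht hu _].
rewrite (lie_anti L (derived_sum_closed hu) (iter_ad_closed ht gF)) !scalerA.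
by rewrite scalerN !scalerA -scaleNr; congr (_ *: _); signs.
Qed.

(** The two terms in which one factor absorbs the Q-part of [x] agree by
    [conv_bracket_derived_sum_iter_ad], hence the 2. *)
Lemma conv_bracket_derived_sum_rcons s x : all_admissible s -> admissible x ->
  conv_bracket 1 derived_sum derived_sum (rcons s x) =
    br (conv_bracket 1 derived_sum derived_sum s) x.2.2 +
    2%:R *: ((-1) ^+ (oddz x.1 && ~~ oddz (total_degree s)) *:
      conv_bracket 1 (iter_ad^~ (Phi x.2.1)) derived_sum s).
Proof.
move=> hs hx.
have gA t : all_admissible t -> g (1 + x.1 + total_degree t) (iter_ad t (Phi x.2.1)).
  by move=> ht; apply: iter_ad_closed => //; apply: lie_mem_eq (Fg hx) _; ring.
rewrite (conv_bracket_rcons (p := 1) (Y := iter_ad^~ (Phi x.2.1)) (Y' := iter_ad^~ (Phi x.2.1))) //;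
  try exact: derived_sum_closed; try by move=> t ht; apply: derived_sum_rcons.
rewrite (conv_bracket_derived_sum_iter_ad (Fg hx)) // !scalerA -scalerDl.
congr (_ + _ *: _); signs; ring.
Qed.

Lemma quadratic_part_closed s : all_admissible s -> g (2 + total_degree s) (quadratic_part s).
Proof.
case: s => [|x [|y [|z s]]] hs; try exact: (lie_mem0 L).
- have [hx _] := (all_admissible_cons _ _).1 hs.
  apply: (lie_memN L); apply: lie_mem_eq (lie_closed L (dd_Om dd) hx.1) _.
  by rewrite total_degree_cons total_degree_nil; ring.
- have [hx /all_admissible_cons[hy _]] := (all_admissible_cons _ _).1 hs.
  apply: (lie_memZ L); apply: lie_mem_eq (lie_closed L hx.1 hy.1) _.
  by rewrite !total_degree_cons total_degree_nil; ring.
Qed.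

Let Phi0 : Phi 0 = 0. Proof. exact: linear_map0 (dd_Phi_linear dd). Qed.
Let PhiZ c F : Phi (c *: F) = c *: Phi F.
Proof. by rewrite -[_ *: F]addr0 (dd_Phi_linear dd) Phi0 addr0. Qed.

Lemma iter_ad0 s : all_admissible s -> iter_ad s 0 = 0.
Proof.
elim/last_ind: s => [//|s x IH] /all_admissible_rcons[hs hx].
by rewrite iter_ad_rcons IH // (br0l L (fg hx)).
Qed.

Lemma iter_adZ p s (c : K) F : all_admissible s -> g p F -> iter_ad s (c *: F) = c *: iter_ad s F.
Proof.
by move=> hs gF; rewrite -[_ *: F]addr0 (iter_ad_linear _ hs gF (lie_mem0 L p)) iter_ad0 // addr0.
Qed.

(** The left side collects the splittings that feed [x] to the quadratic part. Up to sign it is the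
    derivative of [C, C] / 2 along the Q-part F of [x], that is [F, C], transported by e^(ad f). *)
Lemma quadratic_part_rcons_conv s x : all_admissible s -> admissible x ->
  unshuffle_sum (fun t u => (-1) ^+ (oddz x.1 && oddz (total_degree u)) *:
      iter_ad u (Phi (quadratic_part (rcons t x)))) s
  = - ((-1) ^+ (oddz x.1 && ~~ oddz (total_degree s)) *:
      conv_bracket 1 (iter_ad^~ (Phi x.2.1)) derived_sum s).
Proof.
move=> hs hx; have gOm := dd_Phi dd (dd_Om dd).
elim/last_ind: s hs => [|s y IH].
  move=> _; rewrite /= /conv_bracket /= derived_sum_nil -scaleN1r PhiZ.
  rewrite (dd_Phi_br dd (dd_Om dd) hx.1) (lie_anti L gOm (Fg hx)); signs.
move=> /all_admissible_rcons[hs hy]; rewrite unshuffle_sum_rcons.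
(* With both [x] and [y] in the quadratic part its two slots are full, so only the splitting with
   [t] empty contributes. *)
have nil_lt t : t != [::] -> quadratic_part (rcons (rcons t y) x) = 0.
  by case: t => [|? [|? []]].
rewrite unshuffle_sum_first => [|t u /(unshuffled hs)[_ hu _] t0]; last first.
  by rewrite nil_lt // Phi0 iter_ad0 // !scaler0.
pose Psi t u := (-1) ^+ (oddz x.1 && oddz (total_degree u)) *:
  iter_ad u (Phi (quadratic_part (rcons t x))).
have gPsi t u : all_admissible t -> all_admissible u ->
    g (2 + (total_degree t + x.1) + total_degree u) (Psi t u).
  move=> ht hu; apply: (lie_memZ L); apply: (iter_ad_closed hu); apply: (dd_Phi dd).
  by rewrite -total_degree_rcons; apply: quadratic_part_closed; apply/all_admissible_rcons.
have [|||_ E] := unshuffle_sum_map (s := s) (S := g (2 + total_degree s + x.1))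
  (Psi := Psi) (h := fun F => br F y.2.2) _ _ _.
- exact: (lie_subspace L).
- by move=> c F G gF gG; apply: (lie_linear L _ gF gG (fg hy)).
- move=> t u /(unshuffled hs)[ht hu <-].
  by apply: lie_mem_eq (gPsi _ _ ht hu) _; ring.
rewrite (@eq_unshuffle_sum _ _ _ _ (fun t u => (-1) ^+ (oddz x.1 && oddz y.1) *:
   br (Psi t u) y.2.2)); last first.
  move=> t u /(unshuffled hs)[ht hu _].
  have gl := dd_Phi dd (quadratic_part_closed ((all_admissible_rcons t x).2 (conj ht hx))).
  rewrite /Psi iter_ad_rcons (brZl L _ (iter_ad_closed hu gl) (fg hy)).
  by rewrite scalerA; congr (_ *: _); signs.
rewrite unshuffle_sumZ -E IH // (conv_bracket_iter_ad_derived_sum_rcons (Fg hx)) //.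
have gR : g (x.1 + 1 + 1 + total_degree s) (conv_bracket 1 (iter_ad^~ (Phi x.2.1)) derived_sum s).
  apply: (conv_bracket_closed hs _ derived_sum_closed) => t ht.
  by apply: iter_ad_closed ht (Fg hx).
rewrite (brNl L (lie_memZ L _ gR) (fg hy)) (brZl L _ gR (fg hy)) /=.
rewrite PhiZ (dd_Phi_br dd hy.1 hx.1) (lie_anti L (Fg hy) (Fg hx)).
have gB := lie_closed L (Fg hx) (Fg hy).
rewrite -[- (_ *: br _ (Phi y.2.1))]scaleNr !scalerA (iter_adZ _ hs gB).
rewrite scalerDr opprD addrC !scalerA !scalerN !scalerA -!scaleNr.
by congr (_ *: _ + _ *: _); signs.
Qed.

(* With C = Omega + F this is e^(ad f) [C, C] = [e^(ad f) C, e^(ad f) C],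
   proved one variable at a time. *)
Lemma conv_bracket_derived_sum s : all_admissible s ->
  2%:R *: unshuffle_sum (fun t u => iter_ad u (Phi (quadratic_part t))) s =
    - conv_bracket 1 derived_sum derived_sum s.
Proof.
elim/last_ind: s => [_|s x IH].
  rewrite /= Phi0 /conv_bracket /= derived_sum_nil.
  by rewrite -(dd_Phi_br dd (dd_Om dd) (dd_Om dd)) (dd_OmOm dd) Phi0 !scaler0 oppr0.
move=> /all_admissible_rcons[hs hx].
rewrite unshuffle_sum_rcons quadratic_part_rcons_conv // conv_bracket_derived_sum_rcons //.
have [|||_ E] := unshuffle_sum_map (s := s) (S := g (2 + total_degree s))
  (Psi := fun t u => iter_ad u (Phi (quadratic_part t))) (h := fun F => br F x.2.2) _ _ _.
- exact: (lie_subspace L).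
- by move=> c F G gF gG; apply: (lie_linear L _ gF gG (fg hx)).
- move=> t u /(unshuffled hs)[ht hu <-].
  by apply: lie_mem_eq (iter_ad_closed hu (dd_Phi dd (quadratic_part_closed ht))) _; ring.
have gM : g (2 + total_degree s) (unshuffle_sum (fun t u => iter_ad u (Phi (quadratic_part t))) s).
  apply: (unshuffle_sum_map (h := id) (lie_subspace L _) _ _).1 => // t u.
  move=> /(unshuffled hs)[ht hu <-].
  by apply: lie_mem_eq (iter_ad_closed hu (dd_Phi dd (quadratic_part_closed ht))) _; ring.
rewrite (@eq_unshuffle_sum _ _ _ _ (fun t u => br (iter_ad u (Phi (quadratic_part t))) x.2.2)); last first.
  by move=> t u _; rewrite iter_ad_rcons.
rewrite -E scalerDr -(brZl L _ gM (fg hx)) IH //.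
have gZZ := conv_bracket_closed hs derived_sum_closed derived_sum_closed.
by rewrite (brNl L gZZ (fg hx)) scalerN opprD addrC.
Qed.

(** * The L-infinity identity of the closed form *)

Let P0 : P 0 = 0. Proof. exact: linear_map0 (dd_P_linear dd). Qed.
Let PD F G : P (F + G) = P F + P G.
Proof. by rewrite -[F]scale1r (dd_P_linear dd) !scale1r. Qed.
Let PZ c F : P (c *: F) = c *: P F.
Proof. by rewrite -[_ *: F]addr0 (dd_P_linear dd) P0 addr0. Qed.
Let PN F : P (- F) = - P F.
Proof. by rewrite -scaleN1r PZ scaleN1r. Qed.

(** Apply [dd_ker] to F - P F and G - P G; the term with both projections vanishes because [a] is
    abelian. *)
Lemma P_br p q F G : g p F -> g q G ->
  P (br F G) = P (br F (P G)) + P (br (P F) G).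
Proof.
move=> gF gG; have aF := dd_P dd gF; have aG := dd_P dd gG.
have gPF := dd_a dd aF; have gPG := dd_a dd aG.
have : P (br (F - P F) (G - P G)) = 0.
  apply: (dd_ker dd (p := p) (q := q)); rewrite ?PD ?PN ?(dd_P_id dd aF) ?(dd_P_id dd aG) ?subrr //;
    by apply: (lie_memD L) => //; apply: (lie_memN L).
rewrite (brDl L gF (lie_memN L gPF) (lie_memD L gG (lie_memN L gPG))).
rewrite (brDr L gF gG (lie_memN L gPG)) (brDr L (lie_memN L gPF) gG (lie_memN L gPG)).
rewrite (brNl L gPF gG) (brNl L gPF (lie_memN L gPG)) (brNr L gPF gPG) (brNr L gF gPG).
rewrite (dd_a_abelian dd aF aG) !oppr0 addr0 !PD !PN -addrA -opprD => /eqP.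
by rewrite subr_eq0 => /eqP.
Qed.

(** Expanding the outer operation at its first entry gives [M], which uses the quadratic part of the
    inner value, and [N], which uses its [a]-part. Twice the sum of [P M] is - P[Z, Z], with Z the
    derived sums, and [P_br] splits P[Z, Z] into two halves, each equal to the sum of [N], one of
    them after [unshuffle_sumC]. *)
Lemma derived_bracket_identity_a s : all_admissible s ->
  unshuffle_sum (fun t u => if t is [::] then 0 else
    P (derived_sum ((total_degree t + 1, derived_bracket t) :: u))) s = 0.
Proof.
move=> hs.
have two0 : 2%:R != 0 :> K by have := charK 2; rewrite !inE /= => /negbT.
have hl t : all_admissible t -> admissible (total_degree t + 1, derived_bracket t).
  move=> ht; split => /=; first by apply: lie_mem_eq (quadratic_part_closed ht) _; ring.
  by apply: (dd_P dd); apply: lie_mem_eq (derived_sum_closed ht) _; ring.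
pose M t u := iter_ad u (Phi (quadratic_part t)).
pose N t u := (-1) ^+ (~~ oddz (total_degree t) && oddz (total_degree u)) *:
  P (br (derived_sum u) (P (derived_sum t))).
(* The excluded empty [t] may be put back: its quadratic part is 0 and its [a]-part is P (Phi Om) =
   0. *)
rewrite (@eq_unshuffle_sum _ _ _ _ (fun t u => P (M t u) + N t u)); last first.
  move=> t u /(unshuffled hs)[ht hu _].
  case: t ht => [|x t] ht.
    rewrite /M /N Phi0 iter_ad0 // derived_sum_nil (dd_P_Om dd) (br0r L (derived_sum_closed hu)).
    by rewrite P0 scaler0 addr0.
  rewrite derived_sum_cons //=; last exact: hl.
  by rewrite PD PZ /M /N oddzD addbT.
rewrite unshuffle_sumD.
have gM t u : perm_eq (t ++ u) s -> g (2 + total_degree s) (M t u).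
  move=> /(unshuffled hs)[ht hu <-].
  by apply: lie_mem_eq (iter_ad_closed hu (dd_Phi dd (quadratic_part_closed ht))) _; ring.
have [|_ EM] := unshuffle_sum_map (h := P) (lie_subspace L _) _ gM.
  by move=> *; apply: (dd_P_linear dd).
apply: (scalerI two0); rewrite scaler0 scalerDr -EM -PZ conv_bracket_derived_sum // PN.
pose Q t u := (-1) ^+ oddz (total_degree t) *: br (derived_sum t) (derived_sum u).
have [||_ EQ] := unshuffle_sum_map (s := s) (Psi := Q) (h := P) (lie_subspace L (2 + total_degree s)) _.
- by move=> *; apply: (dd_P_linear dd).
- move=> t u /(unshuffled hs)[ht hu <-]; apply: (lie_memZ L).
  by apply: lie_mem_eq (lie_closed L (derived_sum_closed ht) (derived_sum_closed hu)) _; ring.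
rewrite [P _]EQ (@eq_unshuffle_sum _ _ _ _ (fun t u =>
  (-1) ^+ oddz (total_degree t) *: P (br (derived_sum t) (P (derived_sum u))) + N t u)); last first.
  move=> t u /(unshuffled hs)[ht hu _].
  have gPt := dd_a dd (dd_P dd (derived_sum_closed ht)).
  rewrite /Q PZ (P_br (derived_sum_closed ht) (derived_sum_closed hu)) scalerDr; congr (_ + _).
  rewrite (lie_anti L gPt (derived_sum_closed hu)) PN PZ scalerN scalerA -scaleNr /N.
  by congr (_ *: _); signs.
rewrite unshuffle_sumD unshuffle_sumC (@eq_unshuffle_sum _ _ _ _ N).
  by rewrite -mulr2n -scaler_nat addNr.
move=> t u _; rewrite /N scalerA; congr (_ *: _); signs.
Qed.

Lemma quadratic_part_large s : (2 < size s)%N -> quadratic_part s = 0.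
Proof. by case: s => [|x [|y [|z s]]]. Qed.

Lemma quadratic_part_zero d F u : all_admissible u -> quadratic_part ((d, (0, F)) :: u) = 0.
Proof.
case: u => [|y [|z u]] //= hu; first by rewrite (br0r L (dd_Om dd)) oppr0.
have [[gy _] _] := (all_admissible_cons _ _).1 hu.
by rewrite (br0l L gy) scaler0.
Qed.

(** Inner and outer quadratic part take at most two entries each, so only lists of length 1, 2 and 3
    matter: they express that [br Om] squares to zero, that it is a derivation, and the Jacobi
    identity. *)
Lemma derived_bracket_identity_Q s : all_admissible s ->
  unshuffle_sum (fun t u => if t is [::] then 0 else
    quadratic_part ((total_degree t + 1, derived_bracket t) :: u)) s = 0.
Proof.
have two0 : 2%:R != 0 :> K by have := charK 2; rewrite !inE /= => /negbT.
have gOm := dd_Om dd.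
case: (ltnP 3 (size s)) => [lt3s hs|].
  apply: unshuffle_sum0 => t u p; have [_ hu _] := unshuffled hs p.
  case: t p => // x t p; have := perm_size p; rewrite /= size_cat => E.
  rewrite -[LHS]/(quadratic_part ((total_degree (x :: t) + 1, derived_bracket (x :: t)) :: u)).
  have [lt1t|le_t1] := ltnP 1 (size t).
    by rewrite /derived_bracket (@quadratic_part_large (x :: t)) ?quadratic_part_zero.
  rewrite quadratic_part_large //; rewrite -E ltnS in lt3s.
  exact: leq_trans lt3s (leq_add le_t1 (leqnn (size u))).
case: s => [//|x [|y [|z [|]]]] // _.
- move=> /all_admissible_cons[[gx _] _]; rewrite /= scaler0 addr0.
  rewrite (brNr L gOm (lie_closed L gOm gx)) opprK.
  (* The Jacobi identity for Om, Om and x yields only twice the claim. *)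
  apply: (scalerI two0); rewrite scaler0 scaler_nat mulr2n.
  have := lie_jacobi L gOm gOm gx; rewrite (dd_OmOm dd) (br0l L gx).
  by rewrite (lie_anti L (lie_closed L gOm gx) gOm) => E; rewrite [RHS]E; signs.
- move=> /all_admissible_cons[[gx _] /all_admissible_cons[[gy _] _]] /=.
  have gxy := lie_closed L gx gy.
  rewrite !scaler0 addr0 total_degree_nil oddz0 andbF scale1r (brZr L _ gOm gxy).
  rewrite (brNl L (lie_closed L gOm gx) gy) (brNl L (lie_closed L gOm gy) gx).
  rewrite (lie_jacobi L gOm gx gy).
  move: (br Om (br _ _)) (br (br Om _) _) => F G.
  rewrite !total_degree_cons !total_degree_nil.
  by signs; rewrite ?(addrA, subrr, addNr, add0r)
    ?(addrK, subrK, addKr, addNKr) ?(subrr, addNr).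
- move=> /all_admissible_cons[[gx _] /all_admissible_cons[[gy _]]].
  move=> /all_admissible_cons[[gz _] _] /=.
  have gxy := lie_closed L gx gy; have gxz := lie_closed L gx gz.
  have gyz := lie_closed L gy gz.
  rewrite !(br0r L gOm) !oppr0 !scaler0 !addr0 !add0r.
  rewrite (brZl L _ gxy gz) (brZl L _ gxz gy) (brZl L _ gyz gx).
  rewrite (lie_jacobi L gx gy gz) (lie_anti L gx gyz).
  move: (br (br _ _) _) (br (br _ _) _) => F G.
  by signs; rewrite ?(addrA, subrr, addNr, add0r)
    ?(addrK, subrK, addKr, addNKr) ?(subrr, addNr).
Qed.

Lemma derived_bracket_identity s : all_admissible s ->
  unshuffle_sum (fun t u => if t is [::] then 0 else
    derived_bracket ((total_degree t + 1, derived_bracket t) :: u)) s = 0.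
Proof.
move=> hs; rewrite [LHS]surjective_pairing; congr (_, _).
  rewrite -[RHS](derived_bracket_identity_Q hs).
  have [//|//|_ ->] := unshuffle_sum_map (s := s) (S := setT) (h := fst)
    (Psi := fun t u => if t is [::] then 0 else
       derived_bracket ((total_degree t + 1, derived_bracket t) :: u)) _ _ (fun _ _ _ => I).
  by apply: eq_unshuffle_sum => -[].
rewrite -[RHS](derived_bracket_identity_a hs).
have [//|//|_ ->] := unshuffle_sum_map (s := s) (S := setT) (h := snd)
  (Psi := fun t u => if t is [::] then 0 else
     derived_bracket ((total_degree t + 1, derived_bracket t) :: u)) _ _ (fun _ _ _ => I).
by apply: eq_unshuffle_sum => -[].
Qed.

(** * Graded symmetry and multilinearity of the closed form *)

Lemma iter_ad_rcons_swap p F s x y : g p F -> all_admissible s -> admissible x -> admissible y ->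
  iter_ad (rcons (rcons s x) y) F
    = (-1) ^+ (oddz x.1 && oddz y.1) *: iter_ad (rcons (rcons s y) x) F.
Proof.
by move=> gF hs hx hy; rewrite !iter_ad_rcons (br_fC (iter_ad_closed hs gF) hx hy).
Qed.

Lemma iter_ad_swap p F s1 x y s2 : g p F -> all_admissible (s1 ++ [:: x, y & s2]) ->
  iter_ad (s1 ++ [:: x, y & s2]) F
    = (-1) ^+ (oddz x.1 && oddz y.1) *: iter_ad (s1 ++ [:: y, x & s2]) F.
Proof.
move=> gF; elim/last_ind: s2 => [|s2 z IH].
  move=> /all_admissible_cat[h1 /all_admissible_cons[hx /all_admissible_cons[hy _]]].
  by rewrite -!cat_rcons !cats0 -!cats1 !cats1 (iter_ad_rcons_swap gF).
rewrite -!rcons_cons -!rcons_cat => /all_admissible_rcons[h hz].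
have h' : all_admissible (s1 ++ [:: y, x & s2]).
  by move: h; rewrite !all_admissible_cat !all_admissible_cons; tauto.
by rewrite iter_ad_rcons IH // iter_ad_rcons (brZl L _ (iter_ad_closed h' gF) (fg hz)).
Qed.

Lemma derived_sum_swap s1 x y s2 : all_admissible (s1 ++ [:: x, y & s2]) ->
  derived_sum (s1 ++ [:: x, y & s2])
    = (-1) ^+ (oddz x.1 && oddz y.1) *: derived_sum (s1 ++ [:: y, x & s2]).
Proof.
elim/last_ind: s2 => [|s2 z IH].
  move=> /all_admissible_cat[h1 /all_admissible_cons[hx /all_admissible_cons[hy _]]].
  rewrite -!cat_rcons !cats0 -!cats1 !cats1.
  have h1x : all_admissible (rcons s1 x) by apply/all_admissible_rcons.
  have h1y : all_admissible (rcons s1 y) by apply/all_admissible_rcons.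
  have gZ1 := derived_sum_closed h1.
  have gx := iter_ad_closed h1 (Fg hx); have gy := iter_ad_closed h1 (Fg hy).
  rewrite !derived_sum_rcons // !iter_ad_rcons.
  rewrite (brDl L (p := 1 + total_degree s1 + x.1) _ _ (fg hy)); first last.
  - by apply: (lie_memZ L); apply: lie_mem_eq gx _; ring.
  - exact: (lie_closed L gZ1 (fg hx)).
  rewrite (brDl L (p := 1 + total_degree s1 + y.1) _ _ (fg hx)); first last.
  - by apply: (lie_memZ L); apply: lie_mem_eq gy _; ring.
  - exact: (lie_closed L gZ1 (fg hy)).
  rewrite (br_fC gZ1 hx hy) (brZl L _ gx (fg hy)) (brZl L _ gy (fg hx)).
  rewrite !scalerDr !scalerA -!addrA; congr (_ + _); rewrite addrC.
  by congr (_ *: _ + _ *: _); signs.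
rewrite -!rcons_cons -!rcons_cat => /all_admissible_rcons[h hz].
have h' : all_admissible (s1 ++ [:: y, x & s2]).
  by move: h; rewrite !all_admissible_cat !all_admissible_cons; tauto.
rewrite !derived_sum_rcons // IH // (iter_ad_swap (Fg hz) h).
rewrite (brZl L _ (derived_sum_closed h') (fg hz)) scalerDr !scalerA.
by congr (_ + _ *: _); signs.
Qed.

(** Transpositions of neighbours suffice: [sort_sign_swaps] extends the symmetry to all
    permutations. *)
Lemma derived_bracket_swap s1 x y s2 : all_admissible (s1 ++ [:: x, y & s2]) ->
  derived_bracket (s1 ++ [:: x, y & s2])
    = (-1) ^+ (oddz x.1 && oddz y.1) *: derived_bracket (s1 ++ [:: y, x & s2]).
Proof.
move=> h; congr (_, _); last by rewrite /= derived_sum_swap // PZ.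
case: s1 h => [|w s1] h; last first.
  by rewrite -[RHS]/(_ *: quadratic_part _) !quadratic_part_large ?scaler0 // size_cat /= !addnS !addSn.
case: s2 h => [|w s2] h; last first.
  by rewrite -[RHS]/(_ *: quadratic_part _) !quadratic_part_large ?scaler0.
have [hx /all_admissible_cons[hy _]] := (all_admissible_cons _ _).1 h.
by rewrite /= (lie_anti L hx.1 hy.1) scalerN !scalerA -scaleNr; congr (_ *: _); signs.
Qed.

Section Multilinear.
Variables (d : int) (c : K) (E F : V * V).
Hypotheses (hE : admissible (d, E)) (hF : admissible (d, F)).

Lemma admissible_linear : admissible (d, c *: E + F).
Proof.
split; first exact: (lie_subspace L _).2 hE.1 hF.1.
exact: (dd_a_subspace dd _).2 hE.2 hF.2.
Qed.

Section Context.
Variable s1 : seq X.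
Hypothesis h1 : all_admissible s1.

Let hcat G s : all_admissible s -> admissible (d, G) -> all_admissible (s1 ++ (d, G) :: s).
Proof. by move=> hs hG; apply/all_admissible_cat; split=> //; apply/all_admissible_cons. Qed.

Let tdE G G' s2 :
  total_degree (s1 ++ (d, G) :: s2) = total_degree (s1 ++ (d, G') :: s2).
Proof. by rewrite !total_degree_cat !total_degree_cons. Qed.

Lemma iter_ad_multilinear p G s2 : all_admissible s2 -> g p G ->
  iter_ad (s1 ++ (d, c *: E + F) :: s2) G
    = c *: iter_ad (s1 ++ (d, E) :: s2) G + iter_ad (s1 ++ (d, F) :: s2) G.
Proof.
move=> h2 gG; elim/last_ind: s2 h2 => [_|s2 x IH /all_admissible_rcons[h2 hx]].
  rewrite !cats1 !iter_ad_rcons (brDr L (iter_ad_closed h1 gG) (lie_memZ L c (fg hE)) (fg hF)).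
  by rewrite (brZr L _ (iter_ad_closed h1 gG) (fg hE)).
rewrite -!rcons_cons -!rcons_cat !iter_ad_rcons IH //.
have gE := iter_ad_closed (hcat h2 hE) gG.
have := iter_ad_closed (hcat h2 hF) gG; rewrite -(tdE E) => gF.
by rewrite (lie_linear L _ gE gF (fg hx)).
Qed.

Lemma derived_sum_multilinear s2 : all_admissible s2 ->
  derived_sum (s1 ++ (d, c *: E + F) :: s2)
    = c *: derived_sum (s1 ++ (d, E) :: s2) + derived_sum (s1 ++ (d, F) :: s2).
Proof.
elim/last_ind: s2 => [_|s2 x IH /all_admissible_rcons[h2 hx]].
  have hEF := admissible_linear; have gZ1 := derived_sum_closed h1.
  rewrite !cats1 !derived_sum_rcons // (brDr L gZ1 (lie_memZ L c (fg hE)) (fg hF)).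
  rewrite (brZr L _ gZ1 (fg hE)) (dd_Phi_linear dd) (iter_ad_linear _ h1 (Fg hE) (Fg hF)).
  by rewrite !scalerDr !scalerA [_ * c]mulrC addrACA.
have hcEF := hcat h2 admissible_linear; have hcE := hcat h2 hE; have hcF := hcat h2 hF.
rewrite -!rcons_cons -!rcons_cat !derived_sum_rcons // IH //.
have gZE := derived_sum_closed hcE; have := derived_sum_closed hcF; rewrite -(tdE E) => gZF.
rewrite (lie_linear L _ gZE gZF (fg hx)) (iter_ad_multilinear h2 (Fg hx)).
rewrite (tdE (c *: E + F) E) ?(tdE F E) !scalerDr !scalerA [_ * c]mulrC -!addrA; congr (_ + _).
by rewrite addrCA.
Qed.

Lemma derived_bracket_multilinear s2 : all_admissible s2 ->
  derived_bracket (s1 ++ (d, c *: E + F) :: s2)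
    = c *: derived_bracket (s1 ++ (d, E) :: s2) + derived_bracket (s1 ++ (d, F) :: s2).
Proof.
have EFE : (c *: E + F).1 = c *: E.1 + F.1 by [].
move=> h2; have gE : g (d + 1) E.1 := hE.1; have gF : g (d + 1) F.1 := hF.1.
congr (_, _); last by rewrite /= derived_sum_multilinear // (dd_P_linear dd).
case: s1 h1 => [|x [|y t]] ht; last first.
  by rewrite -[RHS]/(_ *: quadratic_part _ + quadratic_part _) !quadratic_part_large
    ?scaler0 ?addr0 // size_cat /= !addnS !addSn.
- case: s2 h2 => [_|y s2 _] /=; last by rewrite scaler0 addr0.
  have [hx _] := (all_admissible_cons _ _).1 ht.
  rewrite ?EFE (brDr L hx.1 (lie_memZ L c gE) gF) (brZr L _ hx.1 gE).
  by rewrite scalerDr !scalerA mulrC.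
- case: s2 h2 => [_|y [|z s2]] /=; last by rewrite scaler0 addr0.
    rewrite ?EFE (brDr L (dd_Om dd) (lie_memZ L c gE) gF) (brZr L _ (dd_Om dd) gE).
    by rewrite opprD scalerN.
  move=> /all_admissible_cons[hy _]; rewrite ?EFE (lie_linear L _ gE gF hy.1).
  by rewrite scalerDr !scalerA mulrC.
Qed.

End Context.
End Multilinear.
End Derived.

(** * Koszul signs and shuffles *)

Section Koszul.
Variables (K : fieldType) (N : nat) (d : 'I_N -> int).

Definition inv_sign (i : 'I_N) (t : seq 'I_N) : K :=
  \prod_(j <- t | (j < i)%N) (-1) ^+ (oddz (d i) && oddz (d j)).

(** The Koszul sign of a word, one factor per inversion. Words replace permutations so that
    inductions may pass to subwords, which no longer list all of ['I_N]. *)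
Fixpoint sort_sign (t : seq 'I_N) : K :=
  if t is i :: t' then inv_sign i t' * sort_sign t' else 1.

Lemma sort_sign_codom M (f : 'I_M -> 'I_N) :
  sort_sign [seq f i | i <- enum 'I_M] =
  \prod_(i < M) \prod_(j < M | (i < j)%N && (f j < f i)%N) (-1) ^ (d (f i) * d (f j)).
Proof.
elim: M f => [|M IH] f; first by rewrite big_ord0 (size0nil (size_enum_ord 0)).
rewrite enum_ordSl /= -map_comp IH big_ord_recl; congr (_ * _).
  rewrite /inv_sign big_map big_enum_cond /= big_mkcond [RHS]big_mkcond big_ord_recl ltnn /= mul1r.
  by apply: eq_bigr => i _ /=; rewrite exprz_sign oddzM.
apply: eq_bigr => i _.
rewrite [in RHS]big_mkcond big_ord_recl ltn0 /= mul1r [LHS]big_mkcond.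
exact: eq_bigr.
Qed.

Lemma koszul_sort_sign (sigma : 'S_N) :
  koszul K d sigma = sort_sign [seq sigma i | i <- enum 'I_N].
Proof. by rewrite sort_sign_codom. Qed.

Lemma sort_sign_enum : sort_sign (enum 'I_N) = 1.
Proof.
rewrite -[enum _]map_id sort_sign_codom big1 // => i _.
by rewrite big_pred0 // => j; case: ltngtP.
Qed.

Section Swaps.
Variables (V : lmodType K) (F : seq 'I_N -> V).
Hypothesis FC : forall s1 i j s2,
  F (s1 ++ [:: i, j & s2]) = (-1) ^+ (oddz (d i) && oddz (d j)) *: F (s1 ++ [:: j, i & s2]).

Lemma inv_sign_perm i s t : perm_eq s t -> inv_sign i s = inv_sign i t.
Proof. exact: perm_big. Qed.

(** Moving [i] to the front past [k] changes the value by the sign of the pair, and exactly one of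
    the two words has this pair as an inversion. *)
Lemma sort_sign_move s1 i u w : i \notin u ->
  sort_sign (u ++ i :: w) *: F (s1 ++ u ++ i :: w)
    = (inv_sign i (u ++ w) * sort_sign (u ++ w)) *: F (s1 ++ i :: u ++ w).
Proof.
elim: u s1 => [//|k u IH] s1; rewrite in_cons negb_or => /andP[nik niu] /=.
rewrite -scalerA -(cat_rcons k s1) IH // scalerA [in RHS]FC cat_rcons !scalerA.
congr (_ *: _).
rewrite (@inv_sign_perm k (u ++ i :: w) (i :: u ++ w)); last by rewrite -cat1s perm_catCA.
rewrite /inv_sign !big_cons.
rewrite -!/(inv_sign _ _) [oddz (d k) && _]andbC; set e := _ ^+ _.
have ee : e * e = 1 by rewrite /e -expr2 sqrr_sign.
have := nik; rewrite -val_eqE /= neq_ltn => /orP[] lt.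
  by rewrite lt ltnNge (ltnW lt) /=; ring.
rewrite lt [(i < k)%N]ltnNge (ltnW lt) /=.
by rewrite -[LHS]mul1r -ee; ring.
Qed.

(** Selection sort: the head of [t] is brought to the front of [t'], and the tails are compared by
    induction. *)
Lemma sort_sign_swaps s1 t t' : uniq t -> perm_eq t t' ->
  sort_sign t *: F (s1 ++ t) = sort_sign t' *: F (s1 ++ t').
Proof.
elim: t t' s1 => [|i t IH] t' s1; first by move=> _; rewrite perm_sym => /perm_nilP ->.
move=> /= /andP[nit ut] p.
have /splitPr it' : i \in t' by rewrite -(perm_mem p) mem_head.
case: it' p => u w p.
have p' : perm_eq t (u ++ w).
  by rewrite -(perm_cons i) (perm_trans p) // -cat1s perm_catCA.
rewrite sort_sign_move; last by move: nit; rewrite (perm_mem p') mem_cat negb_or => /andP[].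
by rewrite (inv_sign_perm i p') -!scalerA -!(cat_rcons i s1); congr (_ *: _); apply: IH.
Qed.

End Swaps.
End Koszul.

Section Shuffles.
Variable N : nat.
Implicit Types (S : {set 'I_N}) (sigma : 'S_N).

Definition inside S := [seq i <- enum 'I_N | i \in S].
Definition outside S := [seq i <- enum 'I_N | i \notin S].

Lemma perm_inside_outside S : perm_eq (inside S ++ outside S) (enum 'I_N).
Proof. by rewrite perm_filterC. Qed.

Lemma size_inside S : size (inside S) = #|S|.
Proof. by rewrite cardE [in RHS]/enum_mem /inside enumT. Qed.

Lemma size_inside_outside S : size (inside S ++ outside S) == N.
Proof. by rewrite (perm_size (perm_inside_outside S)) size_enum_ord. Qed.

Lemma inside_outside_inj S : injective (tnth (Tuple (size_inside_outside S))).
Proof.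
apply/tuple_uniqP; rewrite /= (perm_uniq (perm_inside_outside S)); exact: enum_uniq.
Qed.

(** A shuffle is determined by the set of its values on the first [p] positions; this is the inverse
    of that correspondence. *)
Definition shuffle_of S : 'S_N := perm (@inside_outside_inj S).

Lemma shuffle_ofE S : [seq shuffle_of S i | i <- enum 'I_N] = inside S ++ outside S.
Proof.
rewrite -[RHS]/(tval (Tuple (size_inside_outside S))).
rewrite -[in RHS](map_tnth_enum (Tuple (size_inside_outside S))).
by apply: eq_map => i; rewrite permE.
Qed.


Definition lt_ord : rel 'I_N := fun i j => (i < j)%N.

Lemma lt_ord_trans : transitive lt_ord. Proof. by move=> j i k; apply: ltn_trans. Qed.

Lemma sorted_filter_enum (p : pred 'I_N) : sorted lt_ord [seq i <- enum 'I_N | p i].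
Proof.
apply: (sorted_filter lt_ord_trans).
by rewrite -(sorted_map (f := val) (e' := ltn)) val_enum_ord iota_ltn_sorted.
Qed.

Lemma nth_codom sigma (i : 'I_N) : nth i [seq sigma i | i <- enum 'I_N] i = sigma i.
Proof. by rewrite (nth_map i) ?size_enum_ord // nth_ord_enum. Qed.

(** Once both halves are known to be sorted, each is determined by its set of entries, through the
    uniqueness of sorted lists. *)
Lemma sorted_shuffle p sigma :
  shuffle p sigma =
    sorted lt_ord (take p [seq sigma i | i <- enum 'I_N]) &&
    sorted lt_ord (drop p [seq sigma i | i <- enum 'I_N]).
Proof.
have nth_L (i j : 'I_N) : nth i [seq sigma i | i <- enum 'I_N] j = sigma j.
  by rewrite (set_nth_default j) ?nth_codom // size_map size_enum_ord.
set L := [seq sigma i | i <- enum 'I_N] in nth_L *.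
have sL : size L = N by rewrite size_map size_enum_ord.
have [N0|N0] := posnP N.
  rewrite (size0nil (etrans sL N0)) /=; apply/forallP => i.
  by have := ltn_ord i; rewrite {2}N0.
pose i0 := Ordinal N0.
rewrite !(sorted_pairwise lt_ord_trans); apply/idP/andP.
  move=> /forallP sh; split; apply/(pairwiseP i0) => i j.
    rewrite !inE !size_take_min !leq_min sL => /andP[ip iN] /andP[jp jN] lt_ij.
    rewrite !nth_take // (nth_L i0 (Ordinal iN)) (nth_L i0 (Ordinal jN)).
    have /forallP/(_ (Ordinal jN))/implyP := sh (Ordinal iN).
    by apply; rewrite /= lt_ij jp.
  rewrite !inE !size_drop sL !ltn_subRL => iN jN lt_ij.
  rewrite !nth_drop (nth_L i0 (Ordinal iN)) (nth_L i0 (Ordinal jN)).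
  have /forallP/(_ (Ordinal jN))/implyP := sh (Ordinal iN).
  by apply; rewrite /= ltn_add2l lt_ij leq_addr orbT.
move=> [/(pairwiseP i0) s1 /(pairwiseP i0) s2].
apply/forallP => i; apply/forallP => j; apply/implyP => /andP[lt_ij /orP[jp|pi]].
  have ip := ltn_trans lt_ij jp.
  have := s1 i j; rewrite !inE !size_take_min !leq_min sL ip jp !ltn_ord.
  by rewrite !nth_take // !nth_L; apply.
have pj := leq_trans pi (ltnW lt_ij).
have := s2 (i - p)%N (j - p)%N; rewrite !inE !size_drop sL.
rewrite !ltn_sub2rE // !ltn_ord !nth_drop !subnKC // !nth_L; apply => //.
Qed.

Lemma shuffle_shuffle_of S : shuffle #|S| (shuffle_of S).
Proof.
rewrite sorted_shuffle shuffle_ofE take_size_cat ?size_inside //.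
by rewrite drop_size_cat ?size_inside // !sorted_filter_enum.
Qed.

Lemma shuffle_ofK p sigma : (p <= N)%N -> shuffle p sigma ->
  let S := [set i in take p [seq sigma i | i <- enum 'I_N]] in
  #|S| = p /\ shuffle_of S = sigma.
Proof.
move=> le_pN; rewrite sorted_shuffle; set L := map _ _ => /andP[s1 s2] S.
have sL : size L = N by rewrite size_map size_enum_ord.
have uL : uniq L by rewrite map_inj_uniq ?enum_uniq //; apply: perm_inj.
have uT : uniq (take p L) by apply: subseq_uniq (take_subseq _ _) uL.
split.
  by rewrite cardsE; move/card_uniqP: uT => ->; rewrite size_takel // sL.
have E1 : inside S = take p L.
  apply: (irr_sorted_eq lt_ord_trans); [|exact: sorted_filter_enum|exact: s1|].
    by move=> i; apply: ltnn.
  by move=> i; rewrite mem_filter mem_enum inE andbT.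
have E2 : outside S = drop p L.
  apply: (irr_sorted_eq lt_ord_trans); [|exact: sorted_filter_enum|exact: s2|].
    by move=> i; apply: ltnn.
  move=> i; rewrite mem_filter mem_enum inE andbT.
  have : i \in take p L ++ drop p L.
    rewrite cat_take_drop; apply/mapP; exists ((sigma^-1)%g i); first by rewrite mem_enum.
    by rewrite permKV.
  rewrite -[L in uniq L](cat_take_drop p) cat_uniq in uL.
  case/and3P: uL => _ /hasPn dis _; rewrite mem_cat.
  by have := dis i; case: (i \in drop p L) => [/(_ isT)/negbTE ->|_ /orP[->|]].
by apply/permP => i; rewrite -!nth_codom shuffle_ofE E1 E2 cat_take_drop.
Qed.

Lemma sum_shuffles (V : nmodType) (G : nat -> seq 'I_N -> V) :
  \sum_(0 <= p < N.+1) \sum_(sigma : 'S_N | shuffle p sigma)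
     G p [seq sigma i | i <- enum 'I_N]
  = \sum_(S : {set 'I_N}) G #|S| (inside S ++ outside S).
Proof.
rewrite big_mkord pair_big_dep /=.
rewrite (reindex_onto (fun S => (inord #|S| : 'I_N.+1, shuffle_of S))
  (fun ps => [set i in take ps.1 [seq ps.2 i | i <- enum 'I_N]])) /=; last first.
  move=> [p sigma] /= sh; have [|E1 ->] := shuffle_ofK _ sh; first by rewrite -ltnS.
  by rewrite E1 inord_val.
have leS S : (#|S| < N.+1)%N by rewrite ltnS -[N in (_ <= N)%N]card_ord max_card.
apply: eq_big => [S|S _]; last by rewrite inordK // shuffle_ofE.
rewrite inordK // shuffle_shuffle_of shuffle_ofE take_size_cat ?size_inside //.
by apply/eqP/setP => i; rewrite inE mem_filter mem_enum andbT.
Qed.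
End Shuffles.

Lemma sum_subsets_cons (T : finType) (V : nmodType) (F : {set T} -> V) i (e : seq T) :
  i \notin e ->
  \sum_(S : {set T} | S \subset i :: e) F S =
  \sum_(S : {set T} | S \subset e) F (i |: S) + \sum_(S : {set T} | S \subset e) F S.
Proof.
move=> ie; rewrite (bigID (fun S : {set T} => i \in S)) /=; congr (_ + _); last first.
  apply: eq_bigl => S; apply/andP/idP => [[/fintype.subsetP Sie iS]|/fintype.subsetP Se].
    apply/fintype.subsetP => j jS; have := Sie j jS; rewrite in_cons => /orP[/eqP ji|//].
    by rewrite -ji jS in iS.
  split; last by apply: contra ie; apply: Se.
  by apply/fintype.subsetP => j /Se; rewrite in_cons => ->; rewrite orbT.
rewrite (reindex_onto (fun S => i |: S) (fun S => S :\ i)) /=; last first.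
  by move=> S /andP[_ iS]; rewrite finset.setD1K.
apply: eq_bigl => S; rewrite setU11 andbT; apply/andP/idP.
  move=> [/fintype.subsetP Sie /eqP <-]; apply/fintype.subsetP => j.
  rewrite finset.in_setD1 => /andP[ji /Sie]; rewrite in_cons => /orP[|//].
  by rewrite (negbTE ji).
move=> /fintype.subsetP Se; have iS : i \notin S by apply: contra ie; apply: Se.
split; last by rewrite finset.setU1K.
apply/fintype.subsetP => j; rewrite finset.in_setU1 in_cons => /orP[->//|/Se ->].
by rewrite orbT.
Qed.

Section Unshuffle.
Variables (K : fieldType) (W V : lmodType K) (N : nat) (x : 'I_N -> int * W).
Let d i := (x i).1.

Lemma inv_sign_min i (t : seq 'I_N) : all (lt_ord i) t -> inv_sign K d i t = 1.
Proof.
move=> /allP it; rewrite /inv_sign big_seq_cond big1 // => j /andP[/it].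
by rewrite /lt_ord => lt_ij /(ltn_trans lt_ij); rewrite ltnn.
Qed.

(** As [i] is smaller than all other entries, its inversions are exactly those with the entries of
    [t], which stand before it. *)
Lemma sort_sign_insert i (t u : seq 'I_N) : all (lt_ord i) t -> all (lt_ord i) u ->
  sort_sign K d (t ++ i :: u) =
    (-1) ^+ (oddz (d i) && oddz (total_degree (map x t))) * sort_sign K d (t ++ u).
Proof.
elim: t => [|j t IH] /= it iu; first by rewrite inv_sign_min //; signs; rewrite andbF mul1r.
case/andP: it => lt_ij it; rewrite IH //.
rewrite (@inv_sign_perm _ _ _ _ (t ++ i :: u) (i :: t ++ u)); last by rewrite -cat1s perm_catCA.
rewrite /inv_sign big_cons -/(lt_ord i j) lt_ij -!/(inv_sign K d _ _).
rewrite total_degree_cons oddzD -/(d j) andb_addr signr_addb.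
by rewrite [oddz (d j) && _]andbC; ring.
Qed.

(** Induction on [e] splits the subsets by whether they contain its first element, just as the
    recursion of [unshuffle_sum] does. *)
Lemma unshuffle_sum_subsets (Psi : seq (int * W) -> seq (int * W) -> V) (e : seq 'I_N) :
  sorted (@lt_ord N) e ->
  \sum_(S : {set 'I_N} | S \subset e)
     sort_sign K d ([seq i <- e | i \in S] ++ [seq i <- e | i \notin S]) *:
     Psi [seq x i | i <- e & i \in S] [seq x i | i <- e & i \notin S]
  = unshuffle_sum Psi [seq x i | i <- e].
Proof.
elim: e Psi => [|i e IH] Psi.
  move=> _; rewrite (big_pred1 finset.set0) /=; last first.
    by move=> S /=; rewrite -finset.subset0; apply/fintype.subsetP/fintype.subsetP => s0 j /s0; rewrite ?inE.
  by rewrite scale1r.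
rewrite /= (path_sortedE (@lt_ord_trans N)) => /andP[ie se].
have nie : i \notin e by apply/negP => /(allP ie); rewrite /lt_ord ltnn.
have fE (S : {set 'I_N}) : [seq j <- e | j \in i |: S] = [seq j <- e | j \in S].
  apply: eq_in_filter => j je; rewrite finset.in_setU1.
  by case: eqP => // ji; rewrite -ji je in nie.
have fE' (S : {set 'I_N}) : [seq j <- e | j \notin i |: S] = [seq j <- e | j \notin S].
  apply: eq_in_filter => j je; rewrite finset.in_setU1.
  by case: eqP => // ji; rewrite -ji je in nie.
have all_f (p : pred 'I_N) : all (lt_ord i) [seq j <- e | p j].
  by apply/allP => j; rewrite mem_filter => /andP[_ /(allP ie)].
rewrite sum_subsets_cons // -!IH //; congr (_ + _); apply: eq_bigr => S Se.
  rewrite finset.setU11 /= !fE !fE' inv_sign_min ?mul1r //.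
  by rewrite all_cat !all_f.
have iS : i \notin S by apply: contra nie; apply: (fintype.subsetP Se).
rewrite (negbTE iS) /= sort_sign_insert // !scalerA; congr (_ *: _); rewrite mulrC.
by [].
Qed.

(** The bridge from the shuffles of the L-infinity axioms to [unshuffle_sum]. The term p = 0 is
    included, which is why the identities above set the summand to 0 on an empty [t]. *)
Lemma sum_koszul_shuffles (Psi : seq (int * W) -> seq (int * W) -> V) :
  \sum_(0 <= p < N.+1) \sum_(sigma : 'S_N | shuffle p sigma)
     koszul K (fun i => (x i).1) sigma *:
       Psi (take p (permuted x sigma)) (drop p (permuted x sigma))
  = unshuffle_sum Psi (permuted x 1%g).
Proof.
have -> : permuted x 1%g = [seq x i | i <- enum 'I_N].
  by apply: eq_map => i; rewrite perm1.
rewrite -unshuffle_sum_subsets; last first.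
  by rewrite -[enum _]filter_predT; apply: sorted_filter_enum.
pose G p L := sort_sign K d L *: Psi (take p [seq x i | i <- L]) (drop p [seq x i | i <- L]).
transitivity (\sum_(0 <= p < N.+1) \sum_(sigma : 'S_N | shuffle p sigma)
     G p [seq sigma i | i <- enum 'I_N]).
  apply: eq_bigr => p _; apply: eq_bigr => sigma _.
  by rewrite /G koszul_sort_sign /permuted -!map_comp.
rewrite sum_shuffles; apply: eq_big => [S|S _].
  by apply/esym/fintype.subsetP => i _; rewrite mem_enum.
rewrite /G map_cat take_size_cat ?drop_size_cat ?size_map ?size_inside //.
Qed.

End Unshuffle.

(** * The Gerstenhaber bracket *)

(* [x] and [- x] must each occur exactly once in the left-nested sum, or the
   rewriting loops. *)
Ltac cancel_term x := rewrite ?(addrAC _ x) ?(addrAC _ (- x)) ?(addrK x) ?(addrNK x).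

Ltac sign_nat := rewrite -?exprD -[LHS]signr_odd -[RHS]signr_odd ?(oddD, oddM) /=;
  repeat match goal with |- context [odd ?n] => case: (odd n) end.

Lemma cancel_associator (V : zmodType) (a b c d e f : V) :
  a + b + (c + d + e) - (a + c + f) = b + d + (e - f).
Proof.
rewrite -[LHS]add0r !opprD !addrA; cancel_term a; cancel_term c.
by rewrite add0r.
Qed.

Section Insertion.
Variables (K : fieldType) (U : lmodType K).
Local Notation cochain := (seq U -> U).
Implicit Types (F G H : cochain) (v w s t u : seq U).

Definition additive_map (W : lmodType K) (F : seq U -> W) : Prop :=
  forall s1 s2 (a : K) x y,
    F (s1 ++ (a *: x + y) :: s2) = a *: F (s1 ++ x :: s2) + F (s1 ++ y :: s2).

Lemma additive_map0 (W : lmodType K) (F : seq U -> W) s1 s2 :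
  additive_map F -> F (s1 ++ 0 :: s2) = 0.
Proof.
move=> Fadd; apply: (linear_map0 (h := fun x => F (s1 ++ x :: s2))).
exact: Fadd.
Qed.

Lemma additive_map_cons (W : lmodType K) (F : seq U -> W) x :
  additive_map F -> additive_map (fun v => F (x :: v)).
Proof. by move=> Fadd s1 s2; apply: Fadd (x :: s1) s2. Qed.

Lemma additive_map_split (W : lmodType K) (J : seq U -> seq U -> W) q :
  (forall u, additive_map (J^~ u)) -> (forall t, additive_map (J t)) ->
  additive_map (fun w => J (take q w) (drop q w)).
Proof.
move=> J1 J2 s1 s2 a x y; rewrite !take_cat !drop_cat; case: ltnP => [_|le_s]; first exact: J2.
case E : (q - size s1)%N => [|k] /=; rewrite ?cats0; [exact: (J2 _ [::])| exact: J1].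
Qed.

(* [ins q H G] is the composition [G o H] in the pre-Lie sense, when [H] has
   [q.+1] inputs: all ways of inserting [H] into an input of [G]. *)
Definition ins q H G : cochain := fun v =>
  \sum_(i < size v) (-1) ^+ (i * q) *:
     G (take i v ++ H (take q.+1 (drop i v)) :: drop (i + q.+1) v).

Lemma ins_nil q H G : ins q H G [::] = 0.
Proof. by rewrite /ins big_ord0. Qed.

Lemma ins_cons q H G x v :
  ins q H G (x :: v) = G (H (x :: take q v) :: drop q v) +
    (-1) ^+ q *: ins q H (fun w => G (x :: w)) v.
Proof.
rewrite /ins big_ord_recl /= mul0n expr0 scale1r; congr (_ + _).
rewrite scaler_sumr; apply: eq_bigr => i _.
by rewrite scalerA -exprD mulSn.
Qed.

Lemma ins_linear q H G G' (c : K) v :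
  ins q H (fun w => c *: G w + G' w) v = c *: ins q H G v + ins q H G' v.
Proof.
rewrite /ins scaler_sumr -big_split; apply: eq_bigr => i _ /=.
by rewrite scalerDr !scalerA mulrC.
Qed.

Lemma eq_ins q H G G' v : (forall w, G w = G' w) -> ins q H G v = ins q H G' v.
Proof. by move=> E; apply: eq_bigr => i _; rewrite E. Qed.

Lemma ins_additive q H G : additive_map H -> additive_map G ->
  additive_map (ins q H G).
Proof.
move=> Ha Ga s1 s2 a x y; elim: s1 G Ga => [|z s1 IH] G Ga /=.
  rewrite !ins_cons (Ha [::]) (Ga [::]) /= scalerDr addrACA; congr (_ + _).
  rewrite [a *: (_ *: _)]scalerA [a * _]mulrC -scalerA -scalerDr -ins_linear.
  by congr (_ *: _); apply: eq_ins => w; rewrite (Ga [::]).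
rewrite !ins_cons IH; last exact: additive_map_cons.
rewrite !scalerDr addrACA; congr (_ + _); last by rewrite !scalerA mulrC.
apply: (additive_map_split (J := fun t u => G (H (z :: t) :: u))) => [u|t].
  by move=> t1 t2 b x' y'; rewrite (Ha (z :: t1)) (Ga [::]).
by move=> t1 t2 b x' y'; rewrite (Ga (H (z :: t) :: t1)).
Qed.

Lemma ins_comp q H (h : U -> U) G v :
  (forall (c : K) x y, h (c *: x + y) = c *: h x + h y) ->
  ins q H (fun w => h (G w)) v = h (ins q H G v).
Proof.
move=> hl; have h0 := linear_map0 hl.
rewrite /ins; elim/big_rec2: _ => [//|i x y _ ->].
by rewrite hl.
Qed.

Lemma ins_short q H G v : multilinear q.+1 H -> additive_map G ->
  (size v <= q)%N -> ins q H G v = 0.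
Proof.
move=> [H0 _] Ga le_vq; rewrite /ins big1 // => i _.
rewrite H0 ?additive_map0 ?scaler0 //.
rewrite size_take_min size_drop neq_ltn gtn_min.
by rewrite (leq_ltn_trans (leq_subr _ _)) ?orbT.
Qed.

(** [H] is inserted either into the first block, which then absorbs [q + r] entries because [H]
    turns [r.+1] of them into one, or into the rest, after passing [q] entries. *)
Lemma ins_split r q H (J : seq U -> seq U -> U) v : multilinear r.+1 H ->
  (forall u, additive_map (J^~ u)) ->
  ins r H (fun w => J (take q w) (drop q w)) v =
    ins r H (J^~ (drop (q + r) v)) (take (q + r) v) +
    (-1) ^+ (q * r) *: ins r H (J (take q v)) (drop q v).
Proof.
move=> Hm; elim: q J v => [|q IH] J v Ja.
  rewrite [X in X + _]ins_short ?size_take_min ?geq_minl // add0r mul0n scale1r drop0.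
  rewrite take0; apply: eq_ins => w; by rewrite take0 drop0.
case: v => [|y v]; first by rewrite /= !ins_nil scaler0 addr0.
rewrite /= !ins_cons /= (IH (fun t u => J (y :: t) u)); last first.
  by move=> u; apply: additive_map_cons (Ja u).
rewrite scalerDr scalerA -exprD mulSn addrA; congr (_ + _ + _).
by rewrite take_takel ?leq_addl // take_drop drop_drop.
Qed.

(* The associator consists of the insertions of [H] and [F] into two different
   inputs of [G]; hence it is graded symmetric in [H] and [F]. *)
Definition associator r q H F G : cochain := fun v =>
  ins r H (ins q F G) v - ins (q + r) (ins r H F) G v.

(** The terms where [H] lands inside an [F] at the first slot of [G] cancel against the second part
    of the associator. In the remaining ones [H] or [F] alone occupies that slot, or neither
    does. *)
Lemma associator_cons r q H F G x v :
  multilinear r.+1 H -> multilinear q.+1 F -> additive_map G ->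
  associator r q H F G (x :: v) =
    (-1) ^+ q *: ins q F (fun w => G (H (x :: take r v) :: w)) (drop r v) +
    (-1) ^+ (r + q * r) *: ins r H (fun w => G (F (x :: take q v) :: w)) (drop q v) +
    (-1) ^+ (q + r) *: associator r q H F (fun w => G (x :: w)) v.
Proof.
move=> Hm Fm Ga; rewrite /associator !ins_cons.
rewrite (@eq_ins r H (fun w => ins q F G (x :: w))
  (fun w => 1 *: G (F (x :: take q w) :: drop q w) +
   (-1) ^+ q *: ins q F (fun w => G (x :: w)) w)); last first.
  by move=> w; rewrite ins_cons scale1r.
rewrite ins_linear scale1r.
pose J t u := G (F (x :: t) :: u).
rewrite (@ins_split r q H J v) //; last first.
  by move=> u t1 t2 a y z; rewrite /J (Fm.2 (x :: t1)) (Ga [::]).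
rewrite (@ins_comp r H (fun z => G (z :: drop (q + r) v)) (fun w => F (x :: w))); last first.
  by move=> a y z; rewrite (Ga [::]).
have Ga2 y c z u : G (y + c *: z :: u) = G (y :: u) + c *: G (z :: u).
  by rewrite addrC (Ga [::]) addrC.
rewrite Ga2 take_takel ?leq_addl // take_drop drop_drop.
rewrite (@ins_comp r H (fun z => (-1) ^+ q *: z) (ins q F (fun w => G (x :: w)))); last first.
  by move=> c y z; rewrite scalerDr !scalerA mulrC.
rewrite !scalerDr !scalerA -!exprD scalerN [(r + q)%N]addnC.
exact: (@cancel_associator U).
Qed.

Lemma associator_sym r q H F G v :
  multilinear r.+1 H -> multilinear q.+1 F -> additive_map G ->
  associator r q H F G v = (-1) ^+ (q * r) *: associator q r F H G v.
Proof.
move=> Hm Fm; elim: v G => [|x v IH] G Ga.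
  by rewrite /associator !ins_nil subrr scaler0.
rewrite !associator_cons // IH; last exact: additive_map_cons.
rewrite !scalerDr !scalerA [X in _ = X + _]addrC.
by congr (_ *: _ + _ *: _ + (_ *: _ + _ *: _)); sign_nat.
Qed.

Lemma ins_multilinear q p H F : multilinear q.+1 H -> multilinear p.+1 F ->
  multilinear (p + q).+1 (ins q H F).
Proof.
move=> Hm Fm; split; last by apply: ins_additive; [exact: Hm.2 | exact: Fm.2].
move=> v sv; rewrite /ins big1 // => i _.
have [le_v|lt_v] := leqP (i + q.+1) (size v); last first.
  rewrite Hm.1 ?(additive_map0 _ _ Fm.2) ?scaler0 //.
  by rewrite size_take_min size_drop neq_ltn gtn_min ltn_subLR ?lt_v ?orbT // ltnW.
rewrite Fm.1 ?scaler0 //; apply: contra sv => /eqP.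
rewrite size_cat /= size_drop size_takel ?(ltnW (ltn_ord i)) // => E.
by rewrite -(subnK le_v) -addSn -E; apply/eqP; rewrite !addnS !addSn; congr _.+1; lia.
Qed.

End Insertion.

Section Bracket.
Variables (K : fieldType) (A B : lmodType K).
Local Notation U := (A * B)%type.
Implicit Types (F G H X Y Z : cochain A B).

Definition cochains (d : int) : set (cochain A B) :=
  in_degree (fun n => [set F : cochain A B | multilinear n.+1 F]) d.

Lemma multilinear0 m : multilinear m (0 : cochain A B).
Proof. by split=> // s1 s2 a x y; rewrite [RHS]addr0 scaler0. Qed.

Lemma multilinearD m (c : K) F G : multilinear m F -> multilinear m G ->
  multilinear m (c *: F + G).
Proof.
move=> [F0 Fa] [G0 Ga]; split=> [s sm|s1 s2 a x y].
  by rewrite -[LHS]/(c *: F s + G s) F0 // G0 // scaler0 addr0.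
rewrite -[LHS]/(c *: F _ + G _) Fa Ga -[RHS]/(a *: (c *: F _ + G _) + (c *: F _ + G _)).
by rewrite !scalerDr !scalerA mulrC addrACA.
Qed.

Lemma cochains_subspace d : subspace (cochains d).
Proof.
case: d => n; split.
- exact: multilinear0.
- by move=> c F G; apply: multilinearD.
- by [].
- by move=> c F G -> ->; rewrite scaler0 addr0.
Qed.

Lemma insDl q H (c : K) F G : ins q H (c *: F + G) = c *: ins q H F + ins q H G.
Proof. by apply/funext => v; rewrite -[RHS]/(c *: _ + _) -ins_linear. Qed.

Lemma insDr q H G (c : K) F : additive_map F ->
  ins q (c *: H + G) F = c *: ins q H F + ins q G F.
Proof.
move=> Fa; apply/funext => v; rewrite -[RHS]/(c *: _ v + _ v) /ins scaler_sumr -big_split.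
by apply: eq_bigr => i _ /=; rewrite Fa scalerDr !scalerA mulrC.
Qed.

(** [ins] runs over all positions of [v]; those past the first [p.+1] leave [H] too few entries,
    where it vanishes by the convention on lengths. *)
Lemma diamondE p q F H v : multilinear p.+1 F -> multilinear q.+1 H ->
  size v = (p + q).+1 -> diamond p.+1 q.+1 F H v = ins q H F v.
Proof.
move=> Fm Hm sv; rewrite /diamond /ins sv -addSn.
rewrite (big_ord_widen_cond (p.+1 + q) xpredT (fun i => (-1) ^+ (i * q) *:
  F (take i v ++ H (take q.+1 (drop i v)) :: drop (i + q.+1) v))) ?leq_addr //.
rewrite big_mkcond /=; apply: eq_bigr => i _; case: ltnP => // lt_pi.
rewrite Hm.1 ?(additive_map0 _ _ Fm.2) ?scaler0 //.
rewrite size_take_min size_drop sv; lia.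
Qed.

Lemma diamond_size p q p' q' F H v : multilinear p.+1 F -> multilinear q.+1 H ->
  size v = (p' + q').+1 -> (p', q') != (p, q) -> diamond p'.+1 q'.+1 F H v = 0.
Proof.
move=> Fm Hm sv neq; rewrite /diamond big1 // => i _.
have [E|ne] := eqVneq q q'; last first.
  rewrite Hm.1 ?(additive_map0 _ _ Fm.2) ?scaler0 //.
  by have := ltn_ord i; rewrite size_take_min size_drop sv; lia.
rewrite Fm.1 ?scaler0 //; have := ltn_ord i.
have : p' != p by apply: contra neq => /eqP ->; rewrite E.
by rewrite size_cat /= size_drop size_take_min sv; lia.
Qed.

(** Among the splittings of the arity summed by [bracket], [diamond_size] kills all but the one that
    matches the arities of [F] and [H]. *)
Lemma bracketE p q F H : multilinear p.+1 F -> multilinear q.+1 H ->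
  bracket F H = ins q H F - (-1) ^+ (p * q) *: ins p F H.
Proof.
move=> Fm Hm; apply/funext => v; rewrite -[RHS]/(_ v - _ *: _ v).
have [sv|sv] := eqVneq (size v) (p + q).+1; last first.
  rewrite (ins_multilinear Hm Fm).1 // (ins_multilinear Fm Hm).1 1?addnC //.
  rewrite scaler0 subrr /bracket big1 // => i _; rewrite /gerstenhaber.
  have si : size v = (i + ((size v).-1 - i)).+1 by have := ltn_ord i; lia.
  have ne : (nat_of_ord i, (size v).-1 - i)%N != (p, q).
    by apply: contra sv => /eqP[<- <-]; apply/eqP.
  rewrite (diamond_size Fm Hm) // (diamond_size Hm Fm) ?scaler0 ?subr0 //.
    by rewrite addnC.
  by apply: contra ne => /eqP[-> ->].
have lp : (p < size v)%N by rewrite sv ltnS leq_addr.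
rewrite /bracket (bigD1 (Ordinal lp)) //= [X in _ + X]big1 ?addr0 => [|i ni].
  have -> : ((size v).-1 - p)%N = q by rewrite sv /= addKn.
  rewrite /gerstenhaber (diamondE Fm Hm) // (diamondE Hm Fm) //.
  by rewrite addnC.
have si : size v = (i + ((size v).-1 - i)).+1 by have := ltn_ord i; lia.
have ne : (nat_of_ord i, (size v).-1 - i)%N != (p, q).
  by apply: contra ni => /eqP[ip _]; apply/eqP/val_inj.
rewrite /gerstenhaber (diamond_size Fm Hm) // (diamond_size Hm Fm) ?scaler0 ?subr0 //.
  by rewrite addnC.
by apply: contra ne => /eqP[-> ->].
Qed.

Lemma bracket_multilinear p q F H : multilinear p.+1 F -> multilinear q.+1 H ->
  multilinear (p + q).+1 (bracket F H).
Proof.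
move=> Fm Hm; rewrite (bracketE Fm Hm) addrC -scaleNr; apply: multilinearD.
  by rewrite addnC; apply: ins_multilinear.
exact: ins_multilinear.
Qed.

(** Disposes of negative degrees, where 0 is the only cochain. Additivity makes [H] vanish when a 0
    is inserted. *)
Lemma bracket0l H : additive_map H -> bracket 0 H = 0.
Proof.
move=> Ha; apply/funext => v; rewrite /bracket big1 // => i _.
rewrite /gerstenhaber /diamond !big1 ?scaler0 ?subr0 // => j _; last by rewrite scaler0.
by rewrite additive_map0 // scaler0.
Qed.

Lemma bracket0r F : additive_map F -> bracket F 0 = 0.
Proof.
move=> Fa; apply/funext => v; rewrite /bracket big1 // => i _.
rewrite /gerstenhaber /diamond !big1 ?scaler0 ?subr0 // => j _; first by rewrite scaler0.
by rewrite additive_map0 // scaler0.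
Qed.

Lemma additive_map_zero : additive_map (0 : cochain A B).
Proof. exact: (multilinear0 0).2. Qed.

(** The symmetry of the associator is the graded pre-Lie identity [pl], used once with each of [X],
    [Y], [Z] outermost. The nine nested insertions that remain are treated as atoms and cancel for
    every choice of parities. *)
Lemma bracket_jacobi p q r X Y Z :
  multilinear p.+1 X -> multilinear q.+1 Y -> multilinear r.+1 Z ->
  bracket (bracket X Y) Z
    = bracket X (bracket Y Z) + (-1) ^+ (q * r) *: bracket (bracket X Z) Y.
Proof.
move=> Xm Ym Zm.
have XYm := bracket_multilinear Xm Ym; have YZm := bracket_multilinear Ym Zm.
have XZm := bracket_multilinear Xm Zm.
rewrite (bracketE XYm Zm) (bracketE Xm YZm) (bracketE XZm Ym).
rewrite (bracketE Xm Ym) (bracketE Ym Zm) (bracketE Xm Zm).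
have insBl m H (c : K) F G : ins m H (F - c *: G) = ins m H F - c *: ins m H G.
  by rewrite addrC -scaleNr insDl scaleNr addrC.
have insBr m H G (c : K) F : additive_map F ->
    ins m (H - c *: G) F = ins m H F - c *: ins m G F.
  by move=> Fa; rewrite addrC -scaleNr insDr // scaleNr addrC.
rewrite !insBl !insBr; try by [apply: Xm.2|apply: Ym.2|apply: Zm.2].
have pl m n k F G H (Fm : multilinear m.+1 F) (Gm : multilinear n.+1 G)
    (Hm : multilinear k.+1 H) :
    ins k H (ins n G F) = ins (n + k) (ins k H G) F +
      (-1) ^+ (n * k) *: (ins n G (ins k H F) - ins (k + n) (ins n G H) F).
  apply/funext => v; have := associator_sym v Hm Gm Fm.2.
  by rewrite /associator => /eqP; rewrite subr_eq addrC => /eqP.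
rewrite (pl _ _ _ _ _ _ Xm Ym Zm) (pl _ _ _ _ _ _ Ym Xm Zm) (pl _ _ _ _ _ _ Zm Xm Ym).
rewrite [(r + q)%N]addnC [(r + p)%N]addnC [(q + p)%N]addnC.
set x1 := ins _ (ins r Z Y) X; set x2 := ins q Y (ins r Z X).
set x3 := ins _ (ins q Y Z) X; set y1 := ins _ (ins r Z X) Y.
set y2 := ins p X (ins r Z Y); set y3 := ins _ (ins p X Z) Y.
set z1 := ins _ (ins q Y X) Z; set z2 := ins _ (ins p X Y) Z.
set z3 := ins p X (ins q Y Z).
clearbody x1 x2 x3 y1 y2 y3 z1 z2 z3; clear.
rewrite -!(signr_odd _ (_ * _)) !oddM !oddD.
by case: (odd p); case: (odd q); case: (odd r) => /=;
  rewrite !(expr0, expr1, scale1r, scaleN1r, opprD, opprK, addrA);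
  apply/eqP; rewrite -subr_eq0 -[X in X == _]add0r !(opprD, opprK) !addrA;
  cancel_term x1; cancel_term x2; cancel_term x3; cancel_term y1; cancel_term y2;
  cancel_term y3; cancel_term z1; cancel_term z2; cancel_term z3.
Qed.

Lemma cochains_additive d F : cochains d F -> additive_map F.
Proof. by case: d => n; [case | move=> ->; apply: additive_map_zero]. Qed.

Lemma bracket_graded_lie : graded_lie cochains (@bracket K A B).
Proof.
have br_closed p q F H : cochains p F -> cochains q H -> cochains (p + q) (bracket F H).
  case: p => p; last first.
    by move=> -> /cochains_additive Ha; rewrite bracket0l //; apply: (cochains_subspace _).1.
  case: q => q; last first.
    by move=> /cochains_additive Fa ->; rewrite bracket0r //; apply: (cochains_subspace _).1.
  exact: bracket_multilinear.
split=> //.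
- exact: cochains_subspace.
- case=> p; last first.
    move=> q a F F' H -> -> /cochains_additive Ha.
    by rewrite scaler0 addr0 bracket0l // scaler0 addr0.
  case=> q; last first.
    move=> a F F' H Fm Fm' ->; rewrite !bracket0r ?scaler0 ?addr0 //;
      apply: (@cochains_additive p) => //; exact: (cochains_subspace p).2.
  move=> a F F' H Fm Fm' Hm.
  rewrite (bracketE (multilinearD a Fm Fm') Hm) (bracketE Fm Hm) (bracketE Fm' Hm).
  rewrite insDl insDr; last exact: Hm.2.
  by rewrite scalerDr opprD scalerBr !scalerA [_ * a]mulrC addrACA.
- case=> p; last first.
    by move=> q F H -> /cochains_additive Ha; rewrite bracket0l ?bracket0r // scaler0 oppr0.
  case=> q; last first.
    by move=> F H /cochains_additive Fa ->; rewrite bracket0l ?bracket0r // scaler0 oppr0.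
  move=> F H Fm Hm; rewrite (bracketE Fm Hm) (bracketE Hm Fm).
  rewrite /oddz /= scalerBr opprB scalerA -oddM signr_odd [(q * p)%N]mulnC.
  by rewrite -expr2 sqrr_sign scale1r addrC.
- case=> p; last first.
    move=> q r F G H -> Gc Hc; have Ga := cochains_additive Gc; have Ha := cochains_additive Hc.
    have GHa := cochains_additive (br_closed _ _ _ _ Gc Hc).
    by rewrite !bracket0l // scaler0 addr0.
  case=> q; last first.
    move=> r F G H Fc -> Hc; have Fa := cochains_additive Fc; have Ha := cochains_additive Hc.
    have FHa := cochains_additive (br_closed _ _ _ _ Fc Hc).
    by rewrite (bracket0r Fa) !bracket0l // !bracket0r // scaler0 addr0.
  case=> r; last first.
    move=> F G H Fc Gc ->; have Fa := cochains_additive Fc; have Ga := cochains_additive Gc.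
    have FGa := cochains_additive (br_closed (Posz p) (Posz q) _ _ Fc Gc).
    by rewrite (bracket0r Ga) !bracket0r // bracket0l // scaler0 addr0.
  move=> F G H Fm Gm Hm; rewrite (bracket_jacobi Fm Gm Hm) -oddM signr_odd.
  by [].
Qed.

Definition acochains (d : int) := in_degree (@a_ K A B) d.

Lemma extend_by_zero_linear (c : K) (h k : seq A -> B) :
  extend_by_zero (c *: h + k) = c *: extend_by_zero h + extend_by_zero k.
Proof.
apply/funext => v; rewrite -[RHS]/(c *: extend_by_zero h v + _).
by rewrite /extend_by_zero /inB; congr (_, _); rewrite /= scaler0 addr0.
Qed.

Lemma proj_a_linear (c : K) F G : proj_a (c *: F + G) = c *: proj_a F + proj_a G.
Proof. by rewrite -extend_by_zero_linear. Qed.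

Lemma multilinear_extend n (h : seq A -> B) :
  multilinear n h -> multilinear n (extend_by_zero h).
Proof.
move=> [h0 ha]; split=> [s sn|s1 s2 c x y]; first by rewrite /extend_by_zero h0 // size_map.
rewrite /extend_by_zero !map_cat /= ha /inB.
by apply: injective_projections => /=; rewrite ?scaler0 ?addr0.
Qed.

Lemma acochains_cochains d F : acochains d F -> cochains d F.
Proof. by case: d => n //= [h [hm ->]]; apply: multilinear_extend. Qed.

Lemma proj_a_multilinear n F : multilinear n F ->
  multilinear n (fun s => (F [seq inA B a | a <- s]).2).
Proof.
move=> [F0 Fa]; split=> [s sn|s1 s2 c x y]; first by rewrite F0 // size_map.
have iE : inA B (c *: x + y) = c *: inA B x + inA B y.
  by apply: injective_projections => /=; rewrite ?scaler0 ?addr0.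
by rewrite !map_cat /= iE Fa.
Qed.

Lemma proj_a_closed d F : cochains d F -> acochains d (proj_a F).
Proof.
case: d => n; first by move=> Fm; eexists; split; first exact: proj_a_multilinear Fm.
by move=> ->.
Qed.
End Bracket.

(** * The subspaces a_n and Q_n *)

Section Subalgebras.
Variables (K : fieldType) (A B : lmodType K).
Local Notation U := (A * B)%type.
Implicit Types (F G H X Y Z : cochain A B).

Lemma acochains_subspace d : subspace (@acochains K A B d).
Proof.
case: d => n; split.
- by exists 0; split; first by split=> // s1 s2 c x y; rewrite [RHS]addr0 scaler0.
- move=> c _ _ [h [[h0 ha] ->]] [k [[k0 ka] ->]].
  exists (c *: h + k); split; last by rewrite extend_by_zero_linear.
  split=> [s sn|s1 s2 b x y].
    by rewrite -[LHS]/(c *: h s + k s) h0 // k0 // scaler0 addr0.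
  rewrite -[LHS]/(c *: h _ + k _) ha ka -[RHS]/(b *: (c *: h _ + k _) + (c *: h _ + k _)).
  by rewrite !scalerDr !scalerA mulrC addrACA.
- by [].
- by move=> c F G -> ->; rewrite scaler0 addr0.
Qed.

Lemma proj_a_id d F : acochains d F -> proj_a F = F.
Proof.
case: d => n; last by move=> ->.
move=> [h [_ ->]]; congr extend_by_zero; apply/funext => s.
by rewrite /extend_by_zero /= -map_comp map_id.
Qed.

(** Elements of [a] take values in [B] and see only [A]-components, so one inserted into another
    gives 0. *)
Lemma ins_acochains p q F H : acochains p F -> acochains (Posz q) H -> ins q H F = 0.
Proof.
move=> aF [k [_ ->]]; apply/funext => v; rewrite /ins big1 // => i _.
case: p aF => [n|n ->]; last by rewrite scaler0.
move=> [h [[_ ha] ->]]; rewrite /extend_by_zero map_cat /=.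
by rewrite (additive_map0 _ _ ha) /inB scaler0.
Qed.

Lemma acochains_abelian p q F H : acochains p F -> acochains q H -> bracket F H = 0.
Proof.
case: p => p; last first.
  by move=> -> /acochains_cochains/cochains_additive Ha; rewrite bracket0l.
case: q => q; last first.
  by move=> /acochains_cochains/cochains_additive Fa ->; rewrite bracket0r.
move=> aF aH; rewrite (bracketE (acochains_cochains aF) (acochains_cochains aH)).
by rewrite (ins_acochains aF aH) (ins_acochains aH aF) scaler0 subr0.
Qed.

Lemma proj_a0 F : proj_a F = 0 -> forall s, (F [seq inA B a | a <- s]).2 = 0.
Proof.
move=> F0 s; have := congr1 (fun G : cochain A B => (G [seq inA B a | a <- s]).2) F0.
by rewrite /proj_a /extend_by_zero /= -[map fst _]map_comp map_id.
Qed.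

Lemma proj_a_eq0 F : (forall s, (F [seq inA B a | a <- s]).2 = 0) -> proj_a F = 0.
Proof. by move=> F0; apply/funext => v; rewrite /proj_a /extend_by_zero F0. Qed.

(** [proj_a F = 0] means that [F] maps inputs from [A] into [A], a property that insertions
    inherit. *)
Lemma ins_proj_a q F H : proj_a F = 0 -> proj_a H = 0 -> proj_a (ins q H F) = 0.
Proof.
move=> /proj_a0 F0 /proj_a0 H0; apply: proj_a_eq0 => s; rewrite /ins.
elim/big_rec: _ => [//|i x _ x0] /=; rewrite x0 addr0.
have HE t : H [seq inA B a | a <- t] = inA B (H [seq inA B a | a <- t]).1.
  by apply: injective_projections => //=; apply: H0.
by rewrite -!map_drop -!map_take HE -map_cons -map_cat F0 scaler0.
Qed.

Lemma bracket_proj_a p q F H : cochains p F -> cochains q H ->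
  proj_a F = 0 -> proj_a H = 0 -> proj_a (bracket F H) = 0.
Proof.
have p0 : proj_a (0 : cochain A B) = 0 by apply: proj_a_eq0.
case: p => p; last by move=> -> /cochains_additive Ha _ _; rewrite bracket0l.
case: q => q; last by move=> /cochains_additive Fa -> _ _; rewrite bracket0r.
move=> Fm Hm PF PH; rewrite (bracketE Fm Hm) addrC -scaleNr proj_a_linear.
by rewrite !ins_proj_a // scaler0 addr0.
Qed.

(* [component j s F] is the part of [F s] in which exactly [j] of the entries
   of [s] are replaced by their [B]-component and the others by their
   [A]-component. *)
Fixpoint component (j : nat) (s : seq U) F : U :=
  if s is v :: s' then
    component j s' (fun w => F (inA B v.1 :: w)) +
    (if j is j'.+1 then component j' s' (fun w => F (inB A v.2 :: w)) else 0)
  else if j == 0%N then F [::] else 0.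

Lemma component_linear j s (c : K) F G :
  component j s (fun w => c *: F w + G w) = c *: component j s F + component j s G.
Proof.
elim: s j F G => [|v s IH] j F G /=; first by case: eqP; rewrite ?scaler0 ?addr0.
rewrite IH; case: j => [|j]; first by rewrite !addr0.
by rewrite IH scalerDr addrACA.
Qed.

Lemma eq_component j s F G : (forall w, size w = size s -> F w = G w) ->
  component j s F = component j s G.
Proof.
elim: s j F G => [|v s IH] j F G E /=; first by rewrite E.
congr (_ + _); first by apply: IH => w sw; apply: E; rewrite /= sw.
by case: j => // j; apply: IH => w sw; apply: E; rewrite /= sw.
Qed.

Lemma component0 j s F : (forall w, size w = size s -> F w = 0) -> component j s F = 0.
Proof.
elim: s j F => [|v s IH] j F F0 /=; first by rewrite F0 // if_same.
rewrite IH ?add0r => [|w sw]; last by apply: F0; rewrite /= sw.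
by case: j => [//|j]; apply: IH => w sw; apply: F0; rewrite /= sw.
Qed.

Lemma component_additive j F : additive_map F -> additive_map (fun s => component j s F).
Proof.
move=> Fa s1 s2 c x y; elim: s1 j F Fa => [|v s1 IH] j F Fa /=.
  have AE : inA B (c *: x.1 + y.1) = c *: inA B x.1 + inA B y.1.
    by apply: injective_projections => /=; rewrite ?scaler0 ?addr0.
  have BE : inB A (c *: x.2 + y.2) = c *: inB A x.2 + inB A y.2.
    by apply: injective_projections => /=; rewrite ?scaler0 ?addr0.
  rewrite AE BE scalerDr addrACA -component_linear; congr (_ + _).
    by apply: eq_component => w _; rewrite (Fa [::]).
  case: j => [|j]; first by rewrite scaler0 addr0.
  by rewrite -component_linear; apply: eq_component => w _; rewrite (Fa [::]).
rewrite IH; last exact: additive_map_cons.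
rewrite scalerDr [RHS]addrACA; congr (_ + _).
case: j => [|j]; first by rewrite scaler0 addr0.
by rewrite IH //; apply: additive_map_cons.
Qed.

Definition countB (t : seq (A + B)) := count (fun u => if u is inr _ then true else false) t.

Lemma component_pure j (t : seq (A + B)) F : additive_map F ->
  component j [seq inAB u | u <- t] F
    = if countB t == j then F [seq inAB u | u <- t] else 0.
Proof.
elim: t j F => [|[a|x] t IH] j F Fa /=; first by rewrite eq_sym.
  rewrite IH; last exact: additive_map_cons.
  rewrite add0n; case: j => [|j]; first by rewrite addr0.
  by rewrite [X in _ + X]component0 ?addr0 // => w _; apply: (additive_map0 [::]).
rewrite [X in X + _]component0 ?add0r => [|w _]; last exact: (additive_map0 [::]).
by case: j => [//|j]; rewrite IH //; apply: additive_map_cons.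
Qed.

Lemma component_large j s F : (size s < j)%N -> component j s F = 0.
Proof.
elim: s j F => [|v s IH] [|j] F //= lt_sj.
by rewrite !IH ?addr0 // ltnW.
Qed.

Lemma sum_component s F : additive_map F ->
  \sum_(j < (size s).+1) component j s F = F s.
Proof.
elim: s F => [|v s IH] F Fa; first by rewrite big_ord1.
rewrite /= big_split /= big_ord_recr /= component_large // addr0 IH; last exact: additive_map_cons.
rewrite big_ord_recl add0r /= IH; last exact: additive_map_cons.
have -> : v = 1 *: inA B v.1 + inB A v.2.
  by rewrite scale1r; apply: injective_projections; rewrite /= ?addr0 ?add0r.
by rewrite (Fa [::]) !scale1r /= addr0 add0r.
Qed.

Lemma component_top s F : additive_map F ->
  component (size s) s F = F [seq inB A v.2 | v <- s].
Proof.
elim: s F => [//|v s IH] F Fa /=; rewrite component_large // add0r IH //.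
exact: additive_map_cons.
Qed.

Lemma pure_typeE (k l : int) (t : seq (A + B)) :
  pure_type k l t <-> (countB t)%:Z = l /\ (size t)%:Z = k + l.
Proof.
rewrite /pure_type -/(countB t).
have -> : (size t = count (fun u : A + B => if u is inl _ then true else false) t + countB t)%N.
  by rewrite /countB; elim: t => //= -[u|u] t ->; rewrite ?addnS ?add0n ?add1n ?addSn.
by split; lia.
Qed.

(** In C^(n+1-i | i-1) the output lies in [A] for [i - 1] inputs from [B] and in [B] for [i] of
    them. For i = 0 the first case is empty, hence the default 0. *)
Definition bidegree_part (F : cochain A B) (i : nat) : cochain A B := fun s =>
  ((if i is j.+1 then component j s F else 0).1, (component i s F).2).

Lemma bidegree_part_C n F (i : 'I_n.+2) : multilinear n.+1 F ->
  C_ n (n.+1%:Z - i%:Z) (i%:Z - 1) (bidegree_part F i).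
Proof.
move=> Fm; have Fa := Fm.2.
have comp0 j s : size s != n.+1 -> component j s F = 0.
  by move=> sn; apply: component0 => w sw; apply: Fm.1; rewrite sw.
have part0 t : countB t != i -> countB t != i.-1 -> bidegree_part F i [seq inAB u | u <- t] = 0.
  rewrite /bidegree_part => ti ti1; rewrite component_pure // (negbTE ti).
  case: (nat_of_ord i) ti1 {ti} => [|j] //= tj.
  by rewrite component_pure // (negbTE tj).
split.
- split=> [s sn|s1 s2 c x y].
    by rewrite /bidegree_part comp0 //; case: (nat_of_ord i) => [|j]; rewrite ?comp0.
  rewrite /bidegree_part (component_additive i Fa); apply: injective_projections => //=.
  case: (nat_of_ord i) => [|j]; first by rewrite scaler0 addr0.
  by rewrite (component_additive j Fa).
- move=> t /pure_typeE[tB tS]; rewrite /bidegree_part component_pure //.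
  by case: eqP => // E; lia.
- move=> t /pure_typeE[tB tS]; rewrite /bidegree_part.
  case: (nat_of_ord i) tB tS => [//|j] tB tS; rewrite component_pure //=.
  by case: eqP => // E; lia.
- move=> t t1 t2; have [sn|sn] := eqVneq (size t) n.+1; last first.
    rewrite /bidegree_part comp0 ?size_map //.
    by case: (nat_of_ord i) => [|j]; rewrite ?comp0 ?size_map.
  apply: part0; apply/negP => /eqP E.
    by apply: t2; apply/pure_typeE; rewrite E sn; lia.
  case: (posnP i) => i0; first by apply: t2; apply/pure_typeE; rewrite E sn; lia.
  by apply: t1; apply/pure_typeE; rewrite E sn; lia.
Qed.

(** The parts cover everything except the [A]-component on inputs all from [B], which the second
    hypothesis makes 0. *)
Lemma sum_bidegree_part n F s : multilinear n.+1 F ->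
  (forall s, (F [seq inB A x | x <- s]).1 = 0) ->
  \sum_(i < n.+2) bidegree_part F i s = F s.
Proof.
move=> Fm FB; have Fa := Fm.2.
have [sn|sn] := eqVneq (size s) n.+1; last first.
  rewrite (Fm.1 _ sn) big1 // => i _; rewrite /bidegree_part.
  have comp0 j : component j s F = 0.
    by apply: component0 => w sw; apply: Fm.1; rewrite sw.
  by rewrite comp0; case: (nat_of_ord i) => [|j]; rewrite ?comp0.
have sF := sum_component s Fa; rewrite sn in sF.
apply: injective_projections.
  rewrite (big_morph fst (fun _ _ => erefl) erefl) big_ord_recl /= add0r.
  have ct : (component n.+1 s F).1 = 0.
    by rewrite -sn component_top // -(FB [seq v.2 | v <- s]) -map_comp.
  by rewrite -sF [in RHS]big_ord_recr /= ct addr0 (big_morph fst (fun _ _ => erefl) erefl).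
by rewrite (big_morph snd (fun _ _ => erefl) erefl) /= -sF (big_morph snd (fun _ _ => erefl) erefl).
Qed.

(** Of all bidegrees only (-1 | n+1), which sends inputs from [B] into [A], is missing in Q. So Q
    consists of the maps that preserve [B], and its closure under the bracket becomes evident. *)
Lemma QP n F : Q_ n F <->
  multilinear n.+1 F /\ forall s, (F [seq inB A x | x <- s]).1 = 0.
Proof.
split; last first.
  move=> [Fm FB]; exists (bidegree_part F); split.
    by move=> i; apply: bidegree_part_C.
  apply/funext => s; rewrite -[LHS](sum_bidegree_part s Fm FB).
  by elim/big_ind2: _ => // F1 v1 F2 v2 -> ->.
move=> [c [cC ->]]; elim/big_rec: _ => [|i x _ [xm x0]].
  by split; [exact: multilinear0 | move=> s].
have [cm cB1 cB2 cB3] := cC i.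
split=> [|s]; first by rewrite -[c i]scale1r; apply: multilinearD.
rewrite -[LHS]/((c i [seq inB A a | a <- s]).1 + _) x0 addr0.
have [sn|sn] := eqVneq (size s) n.+1; last by rewrite cm.1 // size_map.
have sE : [seq inB A x | x <- s] = [seq inAB u | u <- [seq inr x | x <- s]].
  by rewrite -map_comp.
have pureE k l : pure_type k l ([seq inr x | x <- s] : seq (A + B)) <-> l = n.+1%:Z /\ k = 0.
  rewrite pure_typeE size_map sn /countB count_map.
  rewrite (eq_count (a2 := predT)) // count_predT sn; lia.
rewrite sE; have [i_top|i_ntop] := eqVneq (nat_of_ord i) n.+1.
  by apply: cB2; apply/pureE; rewrite i_top; lia.
by rewrite cB3 //; rewrite pureE; have := ltn_ord i; lia.
Qed.
End Subalgebras.

(** * The exponential of ad D *)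

Lemma sum_fctE (T : Type) (V : nmodType) (I : Type) (r : seq I) (Q : pred I)
  (F : I -> T -> V) x : (\sum_(i <- r | Q i) F i) x = \sum_(i <- r | Q i) F i x.
Proof. by elim/big_rec2: _ => [//|i y f _ <-]. Qed.

Lemma fact_quotient (K : fieldType) (charK : [pchar K] =i pred0) n :
  (n.+1`!%:R)^-1 * n.+1%:R = (n`!%:R)^-1 :> K.
Proof.
rewrite factS natrM invfM mulrC mulVKf //.
by have /pcharf0P charK0 := charK; rewrite charK0.
Qed.

Section Exponential.
Variables (K : fieldType) (A B : lmodType K) (D : {linear A -> B}).
Hypothesis charK : [pchar K] =i pred0.
Local Notation U := (A * B)%type.
Implicit Types (F G H X Y Z : cochain A B) (v : seq U).

Definition shear (u : U) : U := (u.1, u.2 + D u.1).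
Definition unshear (u : U) : U := (u.1, u.2 - D u.1).
Definition nil_map (u : U) : U := (0, D u.1).

Lemma shear_linear (c : K) x y : shear (c *: x + y) = c *: shear x + shear y.
Proof.
apply: injective_projections => //=.
by rewrite linearP scalerDr addrACA.
Qed.

Lemma unshear_linear (c : K) x y : unshear (c *: x + y) = c *: unshear x + unshear y.
Proof.
apply: injective_projections => //=.
by rewrite linearP scalerBr opprD addrACA.
Qed.

Lemma nil_map_linear (c : K) x y : nil_map (c *: x + y) = c *: nil_map x + nil_map y.
Proof.
apply: injective_projections; rewrite /= ?linearP //.
by rewrite scaler0 addr0.
Qed.

Lemma nil_map0 : nil_map 0 = 0. Proof. by rewrite /nil_map linear0. Qed.
Lemma nil_map_nil u : nil_map (nil_map u) = 0.
Proof. by rewrite /nil_map linear0. Qed.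
Lemma shearE u : shear u = u + nil_map u.
Proof. by apply: injective_projections; rewrite //= addr0. Qed.
Lemma unshearE u : unshear u = u - nil_map u.
Proof. by apply: injective_projections; rewrite //= subr0. Qed.
Lemma shear_unshear u : shear (unshear u) = u.
Proof. by apply: injective_projections; rewrite //= subrK. Qed.

Definition shear_conj X : cochain A B := fun v => unshear (X [seq shear u | u <- v]).

Lemma shear_conj_linear (c : K) X Y : shear_conj (c *: X + Y) = c *: shear_conj X + shear_conj Y.
Proof. by apply/funext => v; rewrite /shear_conj unshear_linear. Qed.

Lemma shear_conj_multilinear n X : multilinear n X -> multilinear n (shear_conj X).
Proof.
move=> [X0 Xa]; split=> [s sn|s1 s2 c x y].
  by rewrite /shear_conj X0 ?size_map // unshearE nil_map0 subr0.
by rewrite /shear_conj !map_cat /= shear_linear Xa unshear_linear.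
Qed.

Lemma shear_conj0 : shear_conj 0 = 0.
Proof. by apply/funext => v; rewrite /shear_conj unshearE nil_map0 subr0. Qed.

Lemma shear_conj_closed d X : cochains d X -> cochains d (shear_conj X).
Proof. by case: d => n; [apply: shear_conj_multilinear | move=> ->; apply: shear_conj0]. Qed.

Lemma ins_shear_conj q H X : ins q (shear_conj H) (shear_conj X) = shear_conj (ins q H X).
Proof.
apply/funext => v; rewrite /ins /shear_conj size_map.
have unD : {morph unshear : x y / x + y}.
  by move=> x y; rewrite -[x]scale1r unshear_linear !scale1r.
have un0 : unshear 0 = 0 by rewrite unshearE nil_map0 subr0.
rewrite (big_morph unshear unD un0).
apply: eq_bigr => i _; rewrite -[X in _ = unshear X]addr0 unshear_linear.
rewrite un0 addr0.
by rewrite map_cat /= shear_unshear !map_take !map_drop.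
Qed.

Lemma shear_conj_bracket p q X Y : cochains p X -> cochains q Y ->
  shear_conj (bracket X Y) = bracket (shear_conj X) (shear_conj Y).
Proof.
case: p => p; last first.
  move=> -> Yc; rewrite shear_conj0 !bracket0l ?shear_conj0 //; last exact: cochains_additive Yc.
  exact: cochains_additive (shear_conj_closed Yc).
case: q => q; last first.
  move=> Xc ->; rewrite shear_conj0 !bracket0r ?shear_conj0 //; last exact: cochains_additive Xc.
  exact: cochains_additive (shear_conj_closed Xc).
move=> Xm Ym; rewrite (bracketE (shear_conj_multilinear Xm) (shear_conj_multilinear Ym)).
rewrite (bracketE Xm Ym) !ins_shear_conj.
by rewrite addrC -scaleNr shear_conj_linear addrC scaleNr.
Qed.

Local Notation cD := (cochain_of_map D).

Lemma cochain_of_map_multilinear : multilinear 1 (fun s : seq A => if s is [:: a] then D a else 0).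
Proof.
split=> [[|x [|y s]] //|s1 s2 c x y].
case: s1 => [|z [|w s1]] /=; case: s2 => [|? ?]; rewrite ?linearP ?scaler0 ?addr0 //.
Qed.

Lemma cochain_of_map_a : @a_ K A B 0 cD.
Proof. by eexists; split; first exact: cochain_of_map_multilinear. Qed.

Lemma cD_multilinear : multilinear 1 cD.
Proof. exact: multilinear_extend cochain_of_map_multilinear. Qed.

Lemma cD1 u : cD [:: u] = nil_map u. Proof. by []. Qed.

Lemma ins_into_cD p X : multilinear p.+1 X -> ins p X cD = fun v => nil_map (X v).
Proof.
move=> Xm; apply/funext => v; have [sv|sv] := eqVneq (size v) p.+1; last first.
  rewrite (ins_multilinear Xm cD_multilinear).1 ?add0n //.
  by rewrite Xm.1 ?nil_map0.
rewrite /ins sv big_ord_recl /= take0 drop0 mul0n scale1r -{1 2}sv.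
rewrite take_size drop_size cD1 big1 ?addr0 // => i _.
rewrite cD_multilinear.1 ?scaler0 // size_cat /= size_take sv /bump leq0n add1n.
by have := ltn_ord i; case: ifP; lia.
Qed.

Definition ad_D X := bracket X cD.

Lemma ad_DE p X : multilinear p.+1 X ->
  ad_D X = fun v => ins 0 cD X v - nil_map (X v).
Proof.
move=> Xm; rewrite /ad_D (bracketE Xm cD_multilinear) (ins_into_cD Xm) muln0 scale1r.
by [].
Qed.

Lemma ad_D_closed d X n : cochains d X -> cochains d (iter n ad_D X).
Proof.
move=> Xc; elim: n => [//|n IH] /=.
have := lie_closed (bracket_graded_lie A B) IH (cD_multilinear : cochains 0 cD).
by rewrite addr0.
Qed.

(* [ad_D X] is [sub_D X - D o X]; the two summands commute and the second one
   squares to zero, so that the exponential of [ad_D] conjugates by the shear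
   (a, x) |-> (a, x + D a). *)
Definition sub_D X := ins 0 cD X.

(** [nil_map] squares to zero, so the first input is substituted at most once; two terms of the
    binomial expansion remain, with coefficients 1 and n. *)
Lemma sub_D_cons X x v n : additive_map X ->
  iter n sub_D X (x :: v) = iter n sub_D (fun w => X (x :: w)) v +
    n%:R *: iter n.-1 sub_D (fun w => X (nil_map x :: w)) v.
Proof.
elim: n X => [|n IH] X Xa; first by rewrite scale0r addr0.
rewrite iterSr IH; last exact: ins_additive cD_multilinear.2 Xa.
have E y : (fun w => sub_D X (y :: w)) =
    (1 : K) *: sub_D (fun w => X (y :: w)) + (fun w => X (nil_map y :: w)).
  by apply/funext => w; rewrite /sub_D ins_cons take0 drop0 scale1r cD1 scale1r [RHS]addrC.
have lin m (c : K) Y Z w : iter m sub_D (c *: Y + Z) w = c *: iter m sub_D Y w + iter m sub_D Z w.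
  elim: m Y Z => [//|m IHm] Y Z; rewrite !iterSr.
  by rewrite -IHm; congr (iter _ _ _ _); apply: insDl.
rewrite !E !lin !scale1r -!iterSr nil_map_nil.
have -> : (fun w => X (0 :: w)) = 0 by apply/funext => w; apply: (additive_map0 [::]).
have -> : iter n.-1 sub_D 0 v = 0 by apply: (linear_map0 (h := fun Y => iter n.-1 sub_D Y v)).
rewrite addr0 -addrA; congr (_ + _).
case: n {IH E} => [|n]; first by rewrite scale0r addr0 scale1r.
by rewrite [in RHS]mulrS scalerDl scale1r.
Qed.

Lemma sub_D_large X v n : additive_map X -> (size v < n)%N -> iter n sub_D X v = 0.
Proof.
elim: v X n => [|x v IH] X [|n] // Xa lt_vn; first by rewrite /= /sub_D ins_nil.
have Xxa := additive_map_cons x Xa.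
have Xna := additive_map_cons (nil_map x) Xa.
by rewrite sub_D_cons // (IH _ _ Xxa (ltnW lt_vn)) (IH _ _ Xna lt_vn) scaler0 addr0.
Qed.

(** Since n / n! = 1 / (n-1)!, the second term of [sub_D_cons] is the same series with its index
    shifted; the values at [x] and at [nil_map x] add up to the value at [shear x]. *)
Lemma exp_sub_D X v m : additive_map X -> (size v < m)%N ->
  \sum_(n < m) (n`!%:R)^-1 *: iter n sub_D X v = X [seq shear u | u <- v].
Proof.
elim: v X m => [|x v IH] X [|m] // Xa lt_vm.
  rewrite big_ord_recl big1 ?addr0 => [|i _]; first by rewrite fact0 invr1 scale1r.
  by rewrite sub_D_large ?scaler0.
have Xxa := additive_map_cons x Xa.
have Xna := additive_map_cons (nil_map x) Xa.
under eq_bigr => n _ do rewrite sub_D_cons // scalerDr.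
rewrite big_split IH //=; last exact: ltnW.
rewrite big_ord_recl scale0r scaler0 add0r.
rewrite [in RHS]/= shearE [x + _]addrC -[nil_map x in RHS]scale1r (Xa [::]) scale1r.
rewrite [RHS]addrC; congr (_ + _).
rewrite -(IH _ m Xna lt_vm); apply: eq_bigr => i _ /=.
by rewrite scalerA fact_quotient.
Qed.

Lemma ad_D_iter p X n : multilinear p.+1 X ->
  iter n ad_D X = fun v => iter n sub_D X v - n%:R *: nil_map (iter n.-1 sub_D X v).
Proof.
move=> Xm; elim: n => [|n IH]; first by apply/funext => v; rewrite scale0r subr0.
rewrite iterS (@ad_DE p); last exact: (ad_D_closed (d := p) n Xm).
rewrite IH; set Y := iter n sub_D X; set Z := iter n.-1 sub_D X.
have -> : (fun v => Y v - n%:R *: nil_map (Z v)) =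
   (- n%:R : K) *: (fun v => nil_map (Z v)) + Y.
  by apply/funext => w; rewrite addrC -scaleNr.
apply/funext => v; rewrite insDl -[(_ *: _ + _) v]/(_ *: _ v + _ v).
rewrite (ins_comp _ _ _ _ nil_map_linear) -/(sub_D Z) -/(sub_D Y).
have -> : nil_map (Y v - n%:R *: nil_map (Z v)) = nil_map (Y v).
  by rewrite addrC -scaleNr nil_map_linear nil_map_nil scaler0 add0r.
rewrite iterS -/Y.
have -> : - n%:R *: nil_map (sub_D Z v) = - n%:R *: nil_map (Y v).
  by rewrite /Y /Z; case: (n) => [|k]; rewrite ?oppr0 ?scale0r // -iterS.
by rewrite [_ + sub_D Y v]addrC -addrA -scaleN1r -scalerDl -opprD -mulrSr scaleNr.
Qed.

Lemma exp_ad_D d X : cochains d X -> exists M, forall m, (M <= m)%N ->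
  iter m ad_D X = 0 /\ \sum_(n < m) (n`!%:R)^-1 *: iter n ad_D X = shear_conj X.
Proof.
case: d => p; last first.
  move=> ->; exists 0%N => m _; rewrite shear_conj0.
  have ad0 k : iter k ad_D 0 = 0.
    by elim: k => // k IH; rewrite iterS IH /ad_D bracket0l //; apply: cD_multilinear.2.
  by split=> //; rewrite big1 // => i _; rewrite ad0 scaler0.
(* On [p.+1] inputs [sub_D] vanishes from the power p + 2 on, and [ad_D_iter] also involves the
   power m - 1. *)
move=> Xm; exists p.+3 => m le_pm; have Xa := Xm.2.
have Wm n : multilinear p.+1 (iter n ad_D X) by apply: (ad_D_closed (d := p) n Xm).
split.
  apply/funext => v; have [sv|sv] := eqVneq (size v) p.+1; last by rewrite (Wm m).1.
  rewrite (ad_D_iter _ Xm) !sub_D_large ?nil_map0 ?scaler0 ?subr0 // sv; lia.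
apply/funext => v; rewrite sum_fctE.
have [sv|sv] := eqVneq (size v) p.+1; last first.
  rewrite (shear_conj_multilinear Xm).1 // big1 // => i _.
  by rewrite -[LHS]/(_ *: iter i ad_D X v) (Wm i).1 // scaler0.
transitivity (\sum_(i < m) ((i`!%:R)^-1 *: iter i sub_D X v -
    (i`!%:R)^-1 *: (i%:R *: nil_map (iter i.-1 sub_D X v)))).
  by apply: eq_bigr => i _; rewrite -[LHS]/(_ *: iter i ad_D X v) (ad_D_iter _ Xm) scalerBr.
rewrite sumrB exp_sub_D // ?sv; last by lia.
rewrite /shear_conj unshearE; congr (_ - _).
case: m le_pm => // m le_pm; rewrite big_ord_recl scale0r scaler0 add0r.
have nD : {morph nil_map : x y / x + y}.
  by move=> x y; rewrite -[x]scale1r nil_map_linear !scale1r.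
rewrite -(@exp_sub_D X v m) // ?sv; last by lia.
rewrite (big_morph nil_map nD nil_map0); apply: eq_bigr => i _.
rewrite -[X in _ = nil_map X]addr0 nil_map_linear nil_map0 addr0 lift0 /= scalerA.
by rewrite fact_quotient.
Qed.

End Exponential.

(** * The twisted operations *)

Lemma fsbig_nat_bounded (V : nmodType) (f : nat -> V) M :
  (forall n, (M <= n)%N -> f n = 0) -> \sum_(n \in [set: nat]) f n = \sum_(n < M) f n.
Proof.
move=> f0; rewrite -(fsbig_widen `I_M) ?fsbig_ord //.
by move=> n [_ /= /negP]; rewrite -leqNgt => /f0.
Qed.

Section Twist.
Variables (K : fieldType) (A B : lmodType K) (Omega : cochain A B) (D : {linear A -> B}).
Hypothesis charK : [pchar K] =i pred0.
Hypothesis Om1 : cochains 1 Omega.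
Local Notation cD := (cochain_of_map D).
Local Notation V := (cochain A B).
Local Notation admissible' := (@admissible K V (@cochains K A B) (@acochains K A B)).
Local Notation all_admissible' := (@all_admissible K V (@cochains K A B) (@acochains K A B)).
Local Notation iter_ad' := (@iter_ad K V (@bracket K A B)).
Implicit Types (s : seq (int * (V * V))).

Lemma iter_ad_D n X : foldl (@bracket K A B) X (nseq n cD) = iter n (ad_D D) X.
Proof. by elim: n X => // n IH X; rewrite iterSr /= IH. Qed.

Lemma total_degree_nseq n (x : V * V) : total_degree (nseq n (0, x)) = 0 :> int.
Proof. by elim: n => [|n IH]; rewrite ?total_degree_nil ?total_degree_cons ?IH. Qed.

(** If the distinguished entry is one of the [n] copies of (Omega, D), all choices give the same
    term without sign, because the copies have degree 0, and [n.-1] brackets with D remain. For n =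
    0 the coefficient makes [n.-1] harmless. *)
Lemma ltilde_a_nseq n s :
  ltilde_a (nseq n (0, (Omega, cD)) ++ s) =
    n%:R *: proj_a (iter_ad' s (iter n.-1 (ad_D D) Omega)) +
    \sum_(j < size s)
      (-1) ^+ (oddz (nth (0, (0, 0)) s j).1 && oddz (total_degree (take j s))) *:
      proj_a (iter_ad' (take j s ++ drop j.+1 s) (iter n (ad_D D) (nth (0, (0, 0)) s j).2.1)).
Proof.
rewrite /ltilde_a.
have -> : size (nseq n (0 : int, (Omega, cD)) ++ s) = (n + size s)%N.
  by rewrite size_cat size_nseq.
rewrite big_split_ord /=; congr (_ + _).
  rewrite (eq_bigr (fun=> proj_a (iter_ad' s (iter n.-1 (ad_D D) Omega)))).
    by rewrite sumr_const card_ord scaler_nat.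
  move=> i _; rewrite nth_cat size_nseq ltn_ord nth_nseq ltn_ord mul0r scale1r /=.
  congr proj_a; rewrite takel_cat ?size_nseq ?(ltnW (ltn_ord i)) //.
  rewrite drop_cat size_nseq; have lt_in := ltn_ord i.
  rewrite (_ : (if (i.+1 < n)%N then _ else _) = nseq (n - i.+1) (0, (Omega, cD)) ++ s); last first.
    case: ltnP => [_|le_n]; first by rewrite drop_nseq.
    by have -> : i.+1 = n by [apply/eqP; rewrite eqn_leq lt_in le_n]; rewrite subnn drop0.
  rewrite take_nseq ?(ltnW lt_in) // catA -nseqD map_cat foldl_cat map_nseq /=.
  by rewrite iter_ad_D /iter_ad; congr (foldl _ (iter _ _ _) _); lia.
apply: eq_bigr => j _; rewrite nth_cat size_nseq ltnNge leq_addr /= addKn.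
rewrite exprz_sign oddzM take_cat size_nseq ltnNge leq_addr /= addKn.
rewrite total_degree_cat total_degree_nseq add0r; congr (_ *: proj_a _).
rewrite -addnS drop_cat size_nseq ltnNge leq_addr /= addKn.
by rewrite -catA map_cat map_nseq foldl_cat iter_ad_D.
Qed.

Hypothesis OmOm : bracket Omega Omega = 0.
Hypothesis POm : proj_a (shear_conj D Omega) = 0.

Lemma twist_data : derived_data (@cochains K A B) (@bracket K A B) (@acochains K A B)
  (@proj_a K A B) (shear_conj D) Omega.
Proof.
split=> //.
- exact: bracket_graded_lie.
- exact: acochains_subspace.
- exact: acochains_cochains.
- exact: proj_a_linear.
- exact: proj_a_closed.
- exact: proj_a_id.
- exact: acochains_abelian.
- exact: bracket_proj_a.
- exact: shear_conj_linear.
- exact: shear_conj_closed.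
- exact: shear_conj_bracket.
Qed.

Lemma iter_ad_sum p s M (F : nat -> V) :
  all_admissible' s -> (forall i, cochains p (F i)) ->
  iter_ad' s (\sum_(i < M) (i`!%:R)^-1 *: F i) = \sum_(i < M) (i`!%:R)^-1 *: iter_ad' s (F i).
Proof.
move=> hs Fp; have dd := twist_data.
suff [] : cochains p (\sum_(i < M) (i`!%:R)^-1 *: F i) /\
  iter_ad' s (\sum_(i < M) (i`!%:R)^-1 *: F i) = \sum_(i < M) (i`!%:R)^-1 *: iter_ad' s (F i) by [].
elim/big_rec2: _ => [|i x y _ [gy E]].
  by split; [exact: (cochains_subspace A B _).1 | exact: (iter_ad0 dd hs)].
by split; [exact: (cochains_subspace A B _).2 | rewrite (iter_ad_linear dd _ hs (Fp i) gy) E].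
Qed.

Lemma proj_a_sum M (F : nat -> V) :
  proj_a (\sum_(i < M) (i`!%:R)^-1 *: F i) = \sum_(i < M) (i`!%:R)^-1 *: proj_a (F i).
Proof.
by elim/big_rec2: _ => [|i x y _ <-]; [exact: proj_a_eq0 | rewrite proj_a_linear].
Qed.

(** One bound has to serve Omega and all entries of [s]; the dummy entry [(0, (Omega, 0))] lets
    Omega be treated as one of them. *)
Lemma exp_bound s : all_admissible' s -> exists M, forall m x,
  (M <= m)%N -> x \in (0, (Omega, 0)) :: s ->
  iter m (ad_D D) x.2.1 = 0 /\
  \sum_(n < m) (n`!%:R)^-1 *: iter n (ad_D D) x.2.1 = shear_conj D x.2.1.
Proof.
elim: s => [_|y s IH /all_admissible_cons[hy hs]].
  have [M H] := exp_ad_D D charK Om1; exists M => m x le_m.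
  by rewrite inE => /eqP ->; apply: H.
have [M1 H1] := IH hs; have [M2 H2] := exp_ad_D D charK hy.1.
exists (maxn M1 M2) => m x; rewrite geq_max => /andP[le1 le2].
rewrite !in_cons orbCA => /orP[/eqP ->|xs]; first exact: H2.
by apply: H1 => //; rewrite in_cons.
Qed.

Lemma ltilde_Q_nseq M s : (0 < size s)%N ->
  \sum_(n < M.+2) (n`!%:R)^-1 *: ltilde_Q (nseq n (0, (Omega, cD)) ++ s)
  = quadratic_part (@bracket K A B) Omega s.
Proof.
have large n : (2 < n + size s)%N -> ltilde_Q (nseq n (0, (Omega, cD)) ++ s) = 0.
  move=> lt2; have : (2 < size (nseq n (0 : int, (Omega, cD)) ++ s))%N by rewrite size_cat size_nseq.
  by case: (_ ++ _) => [|[? [? ?]] [|[? [? ?]] [|]]].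
move=> s0; rewrite 2!big_ord_recl big1 => [|i _]; last first.
  by rewrite large ?scaler0 // !lift0; lia.
rewrite addr0 fact0 invr1 scale1r /= scale1r.
case: s s0 large => [//|[d1 [F1 f1]] [|[d2 [F2 f2]] [|z s]]] _ large /=.
- by rewrite expr1z scaleN1r add0r.
- by rewrite addr0 exprz_sign oddzD oddz1 addbT.
- by rewrite addr0.
Qed.

(** The factors 1 / n! turn the brackets with D into exponential series, which [exp_ad_D] sums to
    [shear_conj D]; where Omega is distinguished, the multiplicity n shifts the index by one. *)
Lemma twist_derived_bracket s : (0 < size s)%N -> all_admissible' s ->
  (exists M, forall n, (M <= n)%N -> twist_term ltilde (Omega, cD) s n = 0) /\
  twist ltilde (Omega, cD) s =
    derived_bracket (@bracket K A B) (@proj_a K A B) (shear_conj D) Omega s.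
Proof.
move=> s0 hs; have [M HM] := exp_bound hs.
have dd := twist_data.
have memO : (0, (Omega, 0)) \in (0 : int, (Omega, 0 : V)) :: s by rewrite mem_head.
have mems (j : 'I_(size s)) : nth (0, (0, 0)) s j \in (0 : int, (Omega, 0 : V)) :: s.
  by rewrite in_cons mem_nth ?orbT.
have hsj (j : 'I_(size s)) : admissible' (nth (0, (0, 0)) s j) /\
    all_admissible' (take j s ++ drop j.+1 s).
  have E := cat_take_drop j s; rewrite (drop_nth (0, (0, 0)) (ltn_ord j)) in E.
  by move: hs; rewrite -{1}E !all_admissible_cat all_admissible_cons; tauto.
(* From n = 2 on [ltilde_Q] has at least three arguments, and [n.-1] must still reach the bound
   [M]. *)
have term0 n : (M.+2 <= n)%N -> twist_term ltilde (Omega, cD) s n = 0.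
  move=> le_n; rewrite /twist_term /ltilde ltilde_a_nseq.
  rewrite (_ : ltilde_Q _ = 0); last first.
    have : (2 < size (nseq n (0 : int, (Omega, cD)) ++ s))%N by rewrite size_cat size_nseq; lia.
    by case: (_ ++ _) => [|[? [? ?]] [|[? [? ?]] [|]]].
  have P0 := linear_map0 (@proj_a_linear K A B).
  rewrite (HM n.-1 _ _ memO).1 /=; last by lia.
  rewrite (iter_ad0 dd hs) P0 scaler0 add0r big1 => [|j _]; last first.
    rewrite (HM n _ _ (mems j)).1; last by lia.
    by rewrite (iter_ad0 dd (hsj j).2) P0 scaler0.
  by rewrite scaler0.
split; first by exists M.+2.
rewrite /twist (fsbig_nat_bounded term0).
rewrite [LHS]surjective_pairing [RHS]surjective_pairing; congr (_, _).
  by rewrite (big_morph fst (fun _ _ => erefl) erefl) /= ltilde_Q_nseq.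
rewrite (big_morph snd (fun _ _ => erefl) erefl) /=.
under eq_bigr => n _ do rewrite ltilde_a_nseq scalerDr scaler_sumr.
rewrite big_split exchange_big /=.
have PD : {morph @proj_a K A B : x y / x + y}.
  by move=> x y; rewrite -[x]scale1r proj_a_linear !scale1r.
have PZ (c : K) x : proj_a (c *: x) = c *: @proj_a K A B x.
  by rewrite -[_ *: x]addr0 proj_a_linear (linear_map0 (@proj_a_linear K A B)) addr0.
rewrite /derived_sum PD (big_morph _ PD (linear_map0 (@proj_a_linear K A B))); congr (_ + _).
  have [_ /= <-] := HM _ _ (leqnSn M) memO.
  rewrite (iter_ad_sum (p := 1) M.+1 (F := fun n => iter n (ad_D D) Omega) hs); last first.
    by move=> i; apply: ad_D_closed.
  rewrite (proj_a_sum M.+1 (fun n => iter_ad' s (iter n (ad_D D) Omega))).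
  rewrite big_ord_recl scale0r scaler0 add0r.
  by apply: eq_bigr => i _; rewrite lift0 scalerA fact_quotient.
apply: eq_bigr => j _; rewrite PZ; have [hj hsj'] := hsj j.
have [_ <-] := HM _ _ (leqW (leqnSn M)) (mems j).
move: (nth _ s j) hj => x hj.
rewrite (iter_ad_sum M.+2 hsj' (fun n => ad_D_closed D n hj.1)).
rewrite (proj_a_sum M.+2 (fun n => iter_ad' _ (iter n (ad_D D) x.2.1))) scaler_sumr.
by apply: eq_bigr => i _; rewrite !scalerA mulrC.
Qed.

End Twist.

(** * The graded space Q[1] + a *)

Section GradedSpace.
Variables (K : fieldType) (A B : lmodType K).
Local Notation V := (cochain A B).
Implicit Types (F G H : V).

Definition qcochains (d : int) : set V := in_degree (@Q_ K A B) d.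

Lemma qcochains_cochains d F : qcochains d F -> cochains d F.
Proof. by case: d => // n /QP[]. Qed.

Lemma qcochains_subspace d : subspace (qcochains d).
Proof.
case: d => n; split=> //.
- by apply/QP; split; first exact: multilinear0.
- move=> c F G /QP[Fm F0] /QP[Gm G0]; apply/QP; split; first exact: multilinearD.
  by move=> s; rewrite -[LHS]/(c *: (F _).1 + (G _).1) F0 G0 scaler0 addr0.
- by move=> c F G -> ->; rewrite scaler0 addr0.
Qed.

Lemma ins_preserves_B q F H :
  (forall s, (F [seq inB A x | x <- s]).1 = 0) ->
  (forall s, (H [seq inB A x | x <- s]).1 = 0) ->
  forall s, (ins q H F [seq inB A x | x <- s]).1 = 0.
Proof.
move=> F0 H0 s; rewrite /ins.
have HE t : H [seq inB A x | x <- t] = inB A (H [seq inB A x | x <- t]).2.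
  by apply: injective_projections => //=; apply: H0.
elim/big_rec: _ => [//|i x _ x0] /=; rewrite x0 addr0.
by rewrite -!map_drop -!map_take HE -map_cons -map_cat F0 scaler0.
Qed.

Lemma qcochains_bracket p q F H : qcochains p F -> qcochains q H ->
  qcochains (p + q) (bracket F H).
Proof.
case: p => p; last first.
  move=> -> /qcochains_cochains/cochains_additive Ha; rewrite bracket0l //.
  exact: (qcochains_subspace _).1.
case: q => q; last first.
  move=> /qcochains_cochains/cochains_additive Fa ->; rewrite bracket0r //.
  exact: (qcochains_subspace _).1.
move=> /QP[Fm F0] /QP[Hm H0]; apply/QP; split; first exact: bracket_multilinear.
move=> s; rewrite (bracketE Fm Hm) -[LHS]/((ins q H F _).1 - _ *: (ins p F H _).1).
by rewrite !ins_preserves_B // scaler0 subr0.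
Qed.

Lemma QA_subspace d : subspace (@QA K A B d).
Proof.
split.
  by split; [exact: (qcochains_subspace _).1 | exact: (acochains_subspace A B _).1].
move=> c x y [x1 x2] [y1 y2].
by split; [exact: (qcochains_subspace _).2 | exact: (acochains_subspace A B _).2].
Qed.

Lemma cochains_support d F v : cochains d F -> (size v)%:Z != d + 1 -> F v = 0.
Proof.
case: d => n; last by move=> ->.
move=> Fm sv; apply: Fm.1; apply: contra sv => /eqP->.
by rewrite -addn1 PoszD.
Qed.

(** Different degrees mean different arities, so evaluation on lists of one length isolates one
    summand. The offset [e] is 1 for the shifted Q and 0 for [a]. *)
Lemma cochains_independent (e : int) (s : seq int) (F : int -> V) : uniq s ->
  (forall d, d \in s -> cochains (d + e) (F d)) -> \sum_(d <- s) F d = 0 ->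
  forall d, d \in s -> F d = 0.
Proof.
move=> us Fc F0 d ds; apply/funext => v.
have [sv|sv] := eqVneq (size v)%:Z (d + e + 1); last first.
  exact: cochains_support (Fc d ds) sv.
have := congr1 (fun G : V => G v) F0; rewrite sum_fctE (bigD1_seq d) //=.
rewrite big_seq_cond big1 ?addr0 // => d' /andP[d's ne].
apply: cochains_support (Fc d' d's) _; rewrite sv; apply: contra ne.
by rewrite (inj_eq (addIr _)) (inj_eq (addIr _)) eq_sym.
Qed.

Lemma QA_graded : graded_space (@QA K A B).
Proof.
split; first exact: QA_subspace.
move=> s x us xQ x0 d ds; rewrite [x d]surjective_pairing.
have := congr1 fst x0; rewrite (big_morph fst (fun _ _ => erefl) erefl) => x1.
have := congr1 snd x0; rewrite (big_morph snd (fun _ _ => erefl) erefl) => x2.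
congr (_, _).
  apply: (cochains_independent (e := 1) (F := fun d => (x d).1) us _ x1 ds) => d' d's.
  by have [/qcochains_cochains] := xQ d' d's.
apply: (cochains_independent (e := 0) (F := fun d => (x d).2) us _ x2 ds) => d' d's.
by have [_ /acochains_cochains] := xQ d' d's; rewrite addr0.
Qed.

Lemma QA_admissible (x : int * (V * V)) : QA x.1 x.2 ->
  admissible (@cochains K A B) (@acochains K A B) x.
Proof. by move=> [/qcochains_cochains]. Qed.

Lemma homogeneous_mem (s : seq (int * (V * V))) :
  homogeneous QA s -> forall x, x \in s -> QA x.1 x.2.
Proof. by move=> hs x /(nthP (0, 0))[i lt_i <-]; apply: hs. Qed.

Lemma homogeneous_admissible (s : seq (int * (V * V))) :
  homogeneous QA s -> all_admissible (@cochains K A B) (@acochains K A B) s.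
Proof. by move=> /homogeneous_mem hs x /hs /QA_admissible. Qed.

End GradedSpace.

Lemma perm_enum_codom N (sigma : 'S_N) :
  perm_eq (enum 'I_N) [seq sigma i | i <- enum 'I_N].
Proof.
apply: uniq_perm; first exact: enum_uniq.
  by rewrite map_inj_uniq ?enum_uniq //; apply: perm_inj.
move=> i; rewrite mem_enum; apply/esym/mapP.
by exists ((sigma^-1)%g i); rewrite ?mem_enum ?permKV.
Qed.

(** * The L-infinity axioms for the twisted operations *)

Section TwistedLinfty.
Variables (K : fieldType) (A B : lmodType K) (Omega : cochain A B) (D : {linear A -> B}).
Hypothesis charK : [pchar K] =i pred0.
Hypothesis OmQ : Q_ 1 Omega.
Hypothesis OmOm : bracket Omega Omega = 0.
Hypothesis POm : proj_a (shear_conj D Omega) = 0.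
Local Notation V := (cochain A B).
Local Notation alpha := (Omega, cochain_of_map D).
Local Notation l := (derived_bracket (@bracket K A B) (@proj_a K A B) (shear_conj D) Omega).

Let Om1 : cochains 1 Omega := qcochains_cochains (d := 1) OmQ.
Let dd := twist_data Om1 OmOm POm.

Lemma derived_bracket_closed s : homogeneous QA s -> QA (total_degree s + 1) (l s).
Proof.
move=> hs; have hs' := homogeneous_admissible hs.
split; last first.
  by rewrite addrC; apply: proj_a_closed; exact: (derived_sum_closed dd hs').
have mem := homogeneous_mem hs; rewrite -/(qcochains _ _).
case: s mem {hs hs'} => [|x [|y [|z s]]] mem; try exact: (qcochains_subspace _ _ _).1.
- have [hx _] := mem x (mem_head _ _).
  have := qcochains_bracket (p := 1) OmQ hx; rewrite -/(qcochains _ _) => h.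
  rewrite /= total_degree_cons total_degree_nil addr0 addrC -scaleN1r -[_ *: _]addr0.
  by apply: (qcochains_subspace _ _ _).2 => //; exact: (qcochains_subspace _ _ _).1.
- have [hx _] := mem x (mem_head _ _).
  have [hy _] : QA y.1 y.2 by apply: mem; rewrite !inE eqxx orbT.
  have := qcochains_bracket hx hy; rewrite /= !total_degree_cons total_degree_nil.
  have -> : x.1 + 1 + (y.1 + 1) = x.1 + (y.1 + 0) + 1 + 1 by ring.
  rewrite -[_ *: bracket _ _]addr0 => h.
  by apply: (qcochains_subspace _ _ _).2 => //; exact: (qcochains_subspace _ _ _).1.
Qed.

Lemma twistE s : (0 < size s)%N -> homogeneous QA s -> twist ltilde alpha s = l s.
Proof.
move=> s0 hs.
exact: (twist_derived_bracket charK Om1 OmOm POm s0 (homogeneous_admissible hs)).2.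
Qed.

Lemma twist_finite s : (0 < size s)%N -> homogeneous QA s ->
  finitely_many_nonzero [set: nat] (twist_term ltilde alpha s).
Proof.
move=> s0 hs.
have [[M HM] _] := twist_derived_bracket charK Om1 OmOm POm s0 (homogeneous_admissible hs).
apply: (sub_finite_set _ (finite_II M)) => n [_ /= n0].
by rewrite ltnNge; apply: contra n0 => /HM ->.
Qed.

Lemma twist_Linfty : is_Linfty QA (twist ltilde alpha).
Proof.
have hcons s1 s2 d (x : V * V) : homogeneous (@QA K A B) s1 -> homogeneous QA s2 -> QA d x ->
    homogeneous QA (s1 ++ (d, x) :: s2).
  move=> h1 h2 hx i; rewrite size_cat /= => lt_i; rewrite nth_cat.
  case: ltnP => [/h1 //|le_i]; case E : (i - size s1)%N => [|k] //=.
  by apply: h2; rewrite -ltnS -E ltn_subLR.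
have hperm N (x : 'I_N -> int * (V * V)) (sigma : 'S_N) :
    (forall i, QA (x i).1 (x i).2) -> homogeneous QA (permuted x sigma).
  move=> hx i lt_i.
  have /mapP[j _ ->] : nth (0, 0) (permuted x sigma) i \in permuted x sigma by apply: mem_nth.
  exact: hx.
have sperm N (x : 'I_N -> int * (V * V)) (sigma : 'S_N) : size (permuted x sigma) = N.
  by rewrite size_map size_enum_ord.
split.
- exact: QA_graded.
- move=> s1 s2 d a x y h1 h2 hx hy; have hxy := (QA_subspace A B d).2 a x y hx hy.
  rewrite !twistE ?size_cat ?addnS //; try exact: hcons.
  apply: (derived_bracket_multilinear dd); try exact: homogeneous_admissible.
    exact: (QA_admissible (x := (d, x))).
  exact: (QA_admissible (x := (d, y))).
- by move=> s s0 hs; rewrite twistE //; apply: derived_bracket_closed.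
- move=> N x sigma N0 hx; rewrite !twistE ?sperm //; try exact: hperm.
  (* The word [enum 'I_N] is sorted and has sign 1; its rearrangement by [sigma] has the Koszul sign
     of [sigma]. *)
  have := sort_sign_swaps (K := K) (d := fun i => (x i).1) (F := fun t => l (map x t)) _ [::]
    (enum_uniq 'I_N) (perm_enum_codom sigma).
  rewrite sort_sign_enum scale1r -koszul_sort_sign => E.
  have -> : permuted x 1%g = [seq x i | i <- enum 'I_N].
    by apply: eq_map => i; rewrite perm1.
  rewrite [permuted x sigma](map_comp x sigma); apply: E => s1 i j s2.
  rewrite !map_cat /=; apply: (derived_bracket_swap dd).
  move=> y; rewrite mem_cat !in_cons => /or4P[/mapP[k _ ->]|/eqP ->|/eqP ->|/mapP[k _ ->]];
    exact: QA_admissible.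
- move=> N x N0 hx; have hp1 := hperm N x 1%g hx.
  rewrite -[RHS](derived_bracket_identity charK dd (homogeneous_admissible hp1)).
  (* The axiom starts at p = 1; the term p = 0 on the other side has an empty [t] and vanishes. *)
  rewrite -sum_koszul_shuffles [in RHS]big_ltn //.
  rewrite [X in _ = X + _]big1 ?add0r => [|sigma _]; last by rewrite take0 scaler0.
  apply: eq_big_nat => p /andP[p0 pN]; apply: eq_bigr => sigma _; congr (_ *: _).
  set y := permuted x sigma; have hy : homogeneous QA y by apply: hperm.
  have hm := homogeneous_mem hy.
  have ht : homogeneous QA (take p y).
    by move=> i lt_i; apply: hm; apply: (mem_take (n0 := p)); apply: mem_nth.
  have hd : homogeneous QA (drop p y).
    by move=> i lt_i; apply: hm; apply: (mem_drop (n0 := p)); apply: mem_nth.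
  have st : (0 < size (take p y))%N by rewrite size_takel ?sperm.
  cbv zeta; rewrite (twistE st ht).
  have h0 : homogeneous QA ([::] : seq (int * (V * V))) by [].
  have hl := hcons _ _ _ _ h0 hd (derived_bracket_closed ht); rewrite twistE //.

  by case: (take p y) st.
Qed.

End TwistedLinfty.

(** * Maurer-Cartan elements *)

Section MaurerCartan.
Variables (K : fieldType) (A B : lmodType K).
Hypothesis charK : [pchar K] =i pred0.
Local Notation V := (cochain A B).
Implicit Types (X Omega : V).

Let two0 : 2%:R != 0 :> K.
Proof. by have := charK 2; rewrite !inE /= => /negbT. Qed.

(** In degree 1 the sign (-1)^(1 * 1) makes the two halves of the bracket add up, whence the 2. *)
Lemma bracket_self X u v w : multilinear 2 X ->
  bracket X X [:: u; v; w] = 2%:R *: (X [:: X [:: u; v]; w] - X [:: u; X [:: v; w]]).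
Proof.
move=> Xm; rewrite (bracketE Xm Xm) mul1n expr1 scaleN1r opprK -mulr2n -scaler_nat.
rewrite -[LHS]/(_ *: ins 1 X X _) !ins_cons ins_nil scaler0 addr0 /=.
have -> : X [:: u; v; X [:: w]] = 0 by apply: Xm.1.
by rewrite scaler0 addr0 expr1 scaleN1r.
Qed.

Lemma bracket_self_eq0 X : multilinear 2 X ->
  bracket X X = 0 <-> associative_cochain X.
Proof.
move=> Xm; split=> [X0 u v w|Xa].
  have := bracket_self u v w Xm; rewrite X0 => /esym/eqP.
  by rewrite scaler_eq0 (negbTE two0) subr_eq0 => /eqP.
apply/funext => s; have [ss|ss] := eqVneq (size s) 3; last first.
  by rewrite (bracket_multilinear Xm Xm).1.
case: s ss => [|u [|v [|w [|]]]] // _.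
by rewrite bracket_self // Xa subrr scaler0.
Qed.

Lemma quasi_twilledP X : quasi_twilled X <-> Q_ 1 X /\ bracket X X = 0.
Proof.
split=> [[Xm Xa XB]|[/QP[Xm XB] X0]].
  split; last exact/bracket_self_eq0.
  apply/QP; split=> // s; have [ss|ss] := eqVneq (size s) 2; last by rewrite Xm.1 ?size_map.
  by case: s ss => [|x [|y [|]]] // _; have [z /= ->] := XB x y.
split=> //; first exact/bracket_self_eq0.
move=> x y; exists (X [:: inB A x; inB A y]).2.
by apply: injective_projections => //=; apply: XB [:: x; y].
Qed.

(** On two elements of [A] the shear puts D into the inputs and the unshear subtracts D of the
    [A]-output, so the [B]-component is the right side minus the left side of the deformation
    equation. *)
Lemma strong_deformationP X (D : {linear A -> B}) : Q_ 1 X ->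
  strong_deformation_map X D <-> proj_a (shear_conj D X) = 0.
Proof.
move=> /QP[Xm XB]; have Xa := Xm.2.
have shE a : shear D (inA B a) = 1 *: inA B a + inB A (D a).
  by rewrite scale1r; apply: injective_projections; rewrite /= ?addr0 ?add0r.
have XE a b : X [:: shear D (inA B a); shear D (inA B b)] =
    X [:: inA B a; inA B b] + X [:: inA B a; inB A (D b)] +
    (X [:: inB A (D a); inA B b] + X [:: inB A (D a); inB A (D b)]).
  by rewrite !shE (Xa [::]) (Xa [:: inA B a] [::]) (Xa [:: inB A (D a)] [::]) !scale1r.
have E a b : (shear_conj D X [:: inA B a; inA B b]).2 =
    Defs.mulB X (D a) (D b) + triangle_r X a (D b) + triangle_l X (D a) b + theta X a b -
    D (Defs.mulA X a b + harpoon_l X a (D b) + harpoon_r X (D a) b).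
  rewrite /shear_conj /= XE /=; have /= -> := XB [:: D a; D b]; rewrite addr0.
  have AC (p q r m : B) : p + q + (r + m) = m + q + r + p.
    by rewrite [r + m]addrC addrACA [p + m]addrC -!addrA [p + _]addrC !addrA.
  by rewrite AC.
split.
  move=> [_ hD]; apply: proj_a_eq0 => s; have [ss|ss] := eqVneq (size s) 2.
    by case: s ss => [|a [|b [|]]] // _; rewrite E hD subrr.
  by rewrite (shear_conj_multilinear D Xm).1 ?size_map.
move=> /proj_a0 P0; split; first exact: linearP.
by move=> a b; have := P0 [:: a; b]; rewrite E => /eqP; rewrite subr_eq0 => /eqP.
Qed.

(** Shears compose additively because they fix [A]-components, the only ones that [D] and [D']
    see. *)
Lemma shear_conj_comp (D D' : {linear A -> B}) X :
  shear_conj D' (shear_conj D X) = shear_conj (D \+ D') X.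
Proof.
apply/funext => v; rewrite /shear_conj -map_comp.
have -> : [seq (shear D \o shear D') u | u <- v] = [seq shear (D \+ D') u | u <- v].
  by apply: eq_map => u; rewrite /shear /= -addrA [D' _ + _]addrC.
by rewrite /unshear /= opprD addrA.
Qed.

Section Twisted.
Variables (Omega : V) (D : {linear A -> B}).
Hypothesis OmQ : Q_ 1 Omega.
Hypothesis OmOm : bracket Omega Omega = 0.
Hypothesis POm : proj_a (shear_conj D Omega) = 0.
Local Notation l := (derived_bracket (@bracket K A B) (@proj_a K A B) (shear_conj D) Omega).
Variables (Omega' : V) (D' : {linear A -> B}).
Hypothesis OmQ' : Q_ 1 Omega'.
Local Notation alpha' := (Omega', cochain_of_map D').

Lemma derived_sum_nseq k : derived_sum (@bracket K A B) (shear_conj D) Omega (nseq k (0, alpha')) =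
  iter k (ad_D D') (shear_conj D Omega) +
  k%:R *: iter k.-1 (ad_D D') (shear_conj D Omega').
Proof.
have ADn n F : iter_ad (@bracket K A B) (nseq n (0, alpha')) F = iter n (ad_D D') F.
  by rewrite /iter_ad map_nseq iter_ad_D.
rewrite /derived_sum ADn size_nseq; congr (_ + _).
rewrite (eq_bigr (fun=> iter k.-1 (ad_D D') (shear_conj D Omega'))).
  by rewrite sumr_const card_ord scaler_nat.
move=> i _; have lt_ik := ltn_ord i.
rewrite nth_nseq lt_ik /= scale1r take_nseq ?(ltnW lt_ik) // drop_nseq -nseqD ADn.
by congr (iter _ _ _); lia.
Qed.

Lemma QA_alpha' : QA 0 alpha'.
Proof. by split=> //; exact: cochain_of_map_a. Qed.

Lemma homogeneous_nseq k : homogeneous QA (nseq k (0, alpha')).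
Proof. by move=> i; rewrite size_nseq nth_nseq => ->; exact: QA_alpha'. Qed.

(** In the first component [Omega, Omega] = 0 completes - 2 [Omega, Omega'] - [Omega', Omega'] to
    the bracket of the sum with itself; in the second the exponential of ad D' is composed with that
    of ad D. *)
Lemma mc_sum : exists M,
  (forall k, (M <= k)%N -> l (nseq k (0, alpha')) = 0) /\
  2%:R *: \sum_(k < M) (k`!%:R)^-1 *: l (nseq k (0, alpha')) =
    (- bracket (Omega + Omega') (Omega + Omega'),
     2%:R *: proj_a (shear_conj (D \+ D') (Omega + Omega'))).
Proof.
have Om1 := qcochains_cochains (d := 1) OmQ; have Om1' := qcochains_cochains (d := 1) OmQ'.
have [M1 H1] := exp_ad_D D' charK (shear_conj_closed D Om1).
have [M2 H2] := exp_ad_D D' charK (shear_conj_closed D Om1').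
(* The quadratic part vanishes from k = 3 on, and [k.-1] has to reach [M2]. *)
exists (maxn M1 M2).+3; split.
  move=> k le_k; rewrite /derived_bracket derived_sum_nseq (H1 k _).1 ?(H2 k.-1 _).1; try lia.
  rewrite scaler0 addr0 (linear_map0 (@proj_a_linear K A B)).
  by case: k le_k => [|[|[|k]]].
have L := bracket_graded_lie A B.
rewrite [LHS]surjective_pairing; congr (_, _).
  rewrite -[LHS]/(2%:R *: (\sum_(k < _) _).1) (big_morph fst (fun _ _ => erefl) erefl).
  rewrite /= 3!big_ord_recl big1 => [|i _]; last by rewrite /= scaler0.
  rewrite !lift0 /= fact0 invr1 scaler0 add0r addr0 scale1r expr1 scaleN1r.
  have br_sym : bracket Omega' Omega = bracket Omega Omega'.
    by rewrite (lie_anti L Om1' Om1) expr1 scaleN1r opprK.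
  rewrite (brDl L Om1 Om1' (lie_memD L Om1 Om1')) (brDr L Om1 Om1 Om1') (brDr L Om1' Om1 Om1').
  rewrite OmOm add0r br_sym scalerDr scalerN scalerA.
  by rewrite (_ : 2`! = 2)%N // mulfV // scale1r scaler_nat mulr2n !opprD !addrA.
rewrite -[LHS]/(2%:R *: (\sum_(k < _) _).2) (big_morph snd (fun _ _ => erefl) erefl) /=.
congr (_ *: _); set M := maxn _ _.
pose F k := iter k (ad_D D') (shear_conj D Omega) +
  k%:R *: iter k.-1 (ad_D D') (shear_conj D Omega').
transitivity (proj_a (\sum_(k < M.+3) (k`!%:R)^-1 *: F k)).
  by rewrite proj_a_sum; apply: eq_bigr => k _; rewrite derived_sum_nseq.
congr proj_a; under eq_bigr => k _ do rewrite /F scalerDr.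
rewrite big_split /= (H1 M.+3 _).2; last by rewrite /M; lia.
have cE : shear_conj (D \+ D') (Omega + Omega') =
    shear_conj D' (shear_conj D Omega) + shear_conj D' (shear_conj D Omega').
  by rewrite -shear_conj_comp -[Omega]scale1r !shear_conj_linear !scale1r.
rewrite cE; congr (_ + _).
rewrite big_ord_recl scale0r scaler0 add0r -(H2 M.+2 _).2; last by rewrite /M; lia.
by apply: eq_bigr => k _; rewrite lift0 scalerA fact_quotient.
Qed.

Lemma maurer_cartan_twist :
  maurer_cartan QA (twist ltilde (Omega, cochain_of_map D)) alpha' <->
  bracket (Omega + Omega') (Omega + Omega') = 0 /\
  proj_a (shear_conj (D \+ D') (Omega + Omega')) = 0.
Proof.
have [M [H0 HM]] := mc_sum.
(* The Maurer-Cartan sum starts at k = 1 and [mc_sum] at k = 0; the extra term is the projection of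
   the transported Omega, hence 0. *)
have l0 : l [::] = 0.
  by rewrite /derived_bracket -[[::]]/(nseq 0 (0, alpha')) derived_sum_nseq scale0r addr0 POm.
have tE k : (0 < k)%N -> mc_term (twist ltilde (Omega, cochain_of_map D)) alpha' k =
    (k`!%:R)^-1 *: l (nseq k (0, alpha')).
  move=> k0; rewrite /mc_term twistE ?size_nseq //; exact: homogeneous_nseq.
have sumE : \sum_(k \in [set k | (0 < k)%N]) mc_term (twist ltilde (Omega, cochain_of_map D)) alpha' k
   = \sum_(k < M) (k`!%:R)^-1 *: l (nseq k (0, alpha')).
  rewrite -(@fsbig_nat_bounded _ (fun k => (k`!%:R)^-1 *: l (nseq k (0, alpha')))); last first.
    by move=> k /H0 ->; rewrite scaler0.
  rewrite -[in RHS](fsbig_widen [set k | (0 < k)%N]) //; last first.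
    by move=> [|k] [_] //= _; rewrite l0 scaler0.
  by apply: eq_fsbigr => k; rewrite inE => k0; apply: tE.
have fin : finitely_many_nonzero [set k | (0 < k)%N]
    (mc_term (twist ltilde (Omega, cochain_of_map D)) alpha').
  apply: (sub_finite_set _ (finite_II M)) => k [/= k0].
  by rewrite tE // ltnNge; apply: contra => /H0 ->; rewrite scaler0.
split.
  move=> [_ _]; rewrite sumE => S0; move: HM; rewrite S0 scaler0 => -[/esym/eqP].
  rewrite oppr_eq0 => /eqP -> /esym/eqP.
  by rewrite scaler_eq0 (negbTE two0) => /eqP ->.
move=> [X0 PX0]; split=> //; first exact: QA_alpha'.
apply: (scalerI two0); rewrite sumE HM X0 PX0 !scaler0 oppr0.
by [].
Qed.

End Twisted.
End MaurerCartan.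

Theorem theorem5p8 (K : fieldType) (charK : [pchar K] =i pred0)
    (A B : lmodType K) (Omega : cochain A B) (D : {linear A -> B})
    (hOmega : quasi_twilled Omega) (hD : strong_deformation_map Omega D) :
  let l_twisted := twist ltilde (Omega, cochain_of_map D) in
  [/\ forall s, (0 < size s)%N -> homogeneous QA s ->
        finitely_many_nonzero [set: nat]
          (twist_term ltilde (Omega, cochain_of_map D) s),
      is_Linfty QA l_twisted &
      forall (Omega' : cochain A B) (D' : {linear A -> B}), Q_ 1 Omega' ->
        quasi_twilled (Omega + Omega') /\
        strong_deformation_map (Omega + Omega') (D \+ D')
        <-> maurer_cartan QA l_twisted (Omega', cochain_of_map D')].
Proof.
have [OmQ OmOm] := (quasi_twilledP charK Omega).1 hOmega.
have POm := (strong_deformationP D OmQ).1 hD.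
split.
- by move=> s s0 hs; apply: twist_finite.
- exact: twist_Linfty.
move=> Omega' D' OmQ'.
(* Q_1 is a subspace, so only the two equations for the sum remain on either side of the
   equivalence. *)
have OmQD : Q_ 1 (Omega + Omega').
  by have := (qcochains_subspace A B 1).2 1 _ _ OmQ OmQ'; rewrite scale1r.
rewrite (maurer_cartan_twist charK OmQ OmOm POm D' OmQ') quasi_twilledP //.
by rewrite (strong_deformationP (D \+ D') OmQD); tauto.
Qed.
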